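(* Let $\lambda>0$ and let $\Omega=\{x\in\mathbb{R}^2 : |x|\le 1\}$ be the unit disk. For odd $m=2L+1$, let $V_m^b=\mathrm{span}\{b_{\lambda,j} : -L\le j\le L\}$ be the space spanned by the Fourier-Bessel functions $b_{\lambda,j}(x)=e^{ij\theta}J_j(\lambda r)$, and let $\nu_\alpha$ be the probability measure $\nu_\alpha=(1-\alpha)\frac{dx}{|\Omega|}+\alpha\frac{d\sigma}{|\partial\Omega|}$ on $\Omega$. Then: (1) (Case $\alpha=0$, the uniform measure.) For every $c_1<1/16$ there is a constant $c_0$, depending on $c_1$ and $\lambda$, such that for all sufficiently large $m$, $$K(V_m^b,\nu_0)\ \ge\ c_0+c_1m^2.$$ (2) (Case $0<\alpha<1$.) There is a constant $C$, depending on $\lambda$ and $\alpha$, such that for all sufficiently large $m$, $$K(V_m^b,\nu_\alpha)\ \le\ C+\frac{m}{\alpha}.$$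
   Context: $(r,\theta)$ are the polar coordinates of $x\in\mathbb{R}^2$, and $J_j$ is the Bessel function of the first kind of order $j\in\mathbb{Z}$. Spans are over $\mathbb{C}$. $dx$ is Lebesgue measure on $\Omega$, $|\Omega|$ the area of $\Omega$, $d\sigma$ the arc-length measure on the boundary $\partial\Omega$ (the unit circle), and $|\partial\Omega|$ its length; $\nu_0=dx/|\Omega|$ is the uniform measure. The integer $m$ always has the form $m=2L+1$ with $L\ge 0$ an integer. For an $m$-dimensional space $V_m$ of (continuous, complex-valued) functions on $\Omega$ and a probability measure $\nu$ on $\Omega$, define $$K(V_m,\nu)=\max_{x\in\Omega}\sum_{j=1}^m|L_j(x)|^2,$$ where $(L_1,\dots,L_m)$ is any basis of $V_m$ that is orthonormal in $L^2(\Omega,\nu)$ (the quantity does not depend on the choice of orthonormal basis). *)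

(* Defs.v *)
From HB Require Import structures.
From mathcomp Require Import all_boot all_order all_algebra.
From mathcomp Require Import all_classical all_reals all_analysis.
From mathcomp Require Import measurable_realfun complex.

Set Implicit Arguments.
Unset Strict Implicit.
Unset Printing Implicit Defensive.

Import Order.TTheory GRing.Theory Num.Theory.
Import numFieldNormedType.Exports.

Local Open Scope classical_set_scope.
Local Open Scope complex_scope.
Local Open Scope ring_scope.

(* R^2 carries the product of the Borel sigma-algebras.  The library norm on
   this product type is the sup norm, hence the explicit Euclidean radius. *)
Notation plane R := (measurableTypeR R * measurableTypeR R)%type.

Section Polar.
Context {R : realType}.
Implicit Type x : plane R.

Definition radius x : R := Num.sqrt (x.1 ^+ 2 + x.2 ^+ 2).

(* The angle in ]-pi, pi]; its value at the origin is irrelevant. *)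
Definition angle x : R :=
  if 0 <= (x.2 : R) then acos (x.1 / radius x) else - acos (x.1 / radius x).

Lemma polarE x : x = (radius x * cos (angle x), radius x * sin (angle x)).
Proof.
case: x => a b; rewrite /angle /radius /=.
set r := Num.sqrt _.
have r2 : r ^+ 2 = a ^+ 2 + b ^+ 2 by rewrite sqr_sqrtr// addr_ge0// sqr_ge0.
have r0 : 0 <= r by exact: sqrtr_ge0.
have [rE|rN0] := eqVneq r 0.
  have /eqP := r2; rewrite rE expr0n/= eq_sym paddr_eq0 ?sqr_ge0// !sqrf_eq0.
  by move=> /andP[/eqP -> /eqP ->]; rewrite !mul0r.
have rp : 0 < r by rewrite lt_neqAle eq_sym rN0.
have ar : -1 <= a / r <= 1.
  rewrite -ler_norml normrM normfV (gtr0_norm rp) ler_pdivrMr// mul1r.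
  rewrite -(ler_pXn2r (n := 2))// ?nnegrE ?normr_ge0// real_normK ?num_real// r2.
  by rewrite lerDl sqr_ge0.
have cE : r * cos (acos (a / r)) = a.
  by rewrite acosK ?in_itv//= mulrC divfK.
have sE : r * sin (acos (a / r)) = `|b|.
  rewrite sin_acos// -{1}(ger0_norm r0) -sqrtr_sqr -sqrtrM ?sqr_ge0//.
  rewrite mulrBr mulr1 -exprMn mulrCA divff// mulr1 r2 addrAC subrr add0r.
  by rewrite sqrtr_sqr.
case: ifPn => [b0|]; first by rewrite cE sE ger0_norm.
rewrite -ltNge => b0.
by rewrite cosN sinN mulrN cE sE ltr0_norm// opprK.
Qed.

End Polar.

Section Bessel.
Context {R : realType}.
Implicit Type x : R.

Definition bessel_coeff (n : nat) x (k : nat) : R :=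
  (-1) ^+ k / (k`!%:R * (k + n)`!%:R) * (x / 2) ^+ (k.*2 + n).

Lemma is_cvg_series_bessel (n : nat) x : cvgn (series (bessel_coeff n x)).
Proof.
apply: normed_cvg.
apply: (@series_le_cvg _ _
  (`|x / 2| ^+ n *: exp_coeff ((x / 2) ^+ 2))) => [k|k|k|].
- exact: normr_ge0.
- by rewrite mulr_ge0// ?exprn_ge0// exp_coeff_ge0// sqr_ge0.
- rewrite /bessel_coeff /exp_coeff /=; move: (x / 2) => y.
  rewrite !normrM normrX normrN1 expr1n mul1r normfV (ger0_norm (mulr_ge0 _ _))//.
  rewrite normrX exprD -mul2n exprM real_normK ?num_real//.
  rewrite mulrA [leLHS]mulrC ler_wpM2l ?exprn_ge0// mulrC.
  rewrite ler_wpM2l ?(exprn_ge0 _ (sqr_ge0 _))//.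
  rewrite lef_pV2 ?posrE ?mulr_gt0 ?ltr0n ?fact_gt0//.
  by rewrite ler_peMr ?ler1n ?fact_gt0.
- exact/is_cvg_seriesZ/is_cvg_series_exp_coeff.
Qed.

Definition bessel_nat (n : nat) x : R := limn (series (bessel_coeff n x)).

(* J_(-n) = (-1)^n J_n; note that [Negz n] is -(n + 1). *)
Definition bessel (j : int) x : R :=
  match j with
  | Posz n => bessel_nat n x
  | Negz n => (-1) ^+ n.+1 * bessel_nat n.+1 x
  end.

Definition expi (t : R) : R[i] := cos t +i* sin t.

Definition fourier_bessel (lam : R) (j : int) (x : plane R) : R[i] :=
  expi (j%:~R * angle x) * (bessel j (lam * radius x))%:C.

Lemma bessel0 (j : int) : j != 0 -> bessel j 0 = 0.
Proof.
have nat0 n : bessel_nat n.+1 0 = 0.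
  have E : bessel_coeff n.+1 0 = fun=> 0.
    by apply/funext => k; rewrite /bessel_coeff mul0r !addnS exprS mul0r mulr0.
  rewrite /bessel_nat E; apply/cvg_lim => //.
  suff -> : series (fun=> 0 : R) = fun=> 0 by exact: cvg_cst.
  by apply/funext => k; rewrite /series/= big1.
by case: j => [[//|n]|n] _ /=; rewrite nat0 ?mulr0.
Qed.

(* The choice of the angle does not matter, even at the origin. *)
Lemma fourier_besselE (lam : R) (j : int) (r t : R) : 0 <= r ->
  fourier_bessel lam j (r * cos t, r * sin t) =
  expi (j%:~R * t) * (bessel j (lam * r))%:C.
Proof.
move=> r0; rewrite /fourier_bessel; set x := (_, _).
have rE : radius x = r.
  rewrite /radius/= !exprMn -mulrDr cos2Dsin2 mulr1 sqrtr_sqr.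
  by rewrite ger0_norm.
rewrite rE; have [->|j0] := eqVneq j 0; first by rewrite !mul0r.
have [->|rN0] := eqVneq r 0; first by rewrite mulr0 bessel0// !mulr0.
have [] : (cos (angle x), sin (angle x)) = (cos t, sin t).
  have [] := polarE x; rewrite rE => /(mulfI rN0) <- /(mulfI rN0) <-.
  by [].
move: (angle x) => u cE sE; congr (_ * _).
have natE n : expi (n%:R * u) = expi (n%:R * t).
  elim: n => [|n]; first by rewrite !mul0r.
  rewrite /expi -natr1 !mulrDl !mul1r !cosD !sinD cE sE.
  by case=> -> ->.
case: j {j0} => n; first exact: natE.
have := natE n.+1; rewrite /expi NegzE rmorphN/= !mulNr !cosN !sinN.
by case=> -> ->.
Qed.

End Bessel.

Section Measures.
Context {R : realType}.

Definition disk : set (plane R) := [set x | radius x <= 1].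

Definition leb1 : {sigma_finite_measure set (measurableTypeR R) -> \bar R} :=
  @lebesgue_measure R.

Definition leb2 : {measure set (plane R) -> \bar R} :=
  product_measure1 leb1 leb1.

Lemma measurable_disk : measurable disk.
Proof.
have -> : disk = [set: plane R] `&`
    (fun x : plane R => x.1 ^+ 2 + x.2 ^+ 2 : measurableTypeR R) @^-1` `]-oo, 1].
  rewrite setTI; apply/seteqP; split => x; rewrite /disk/= /radius in_itv/=.
    by rewrite -[X in _ <= X]sqrtr1 ler_sqrt.
  by rewrite -[X in _ -> _ <= X]sqrtr1 ler_sqrt.
apply: measurable_funD => //=.
- by apply: measurable_funX; exact: measurable_fst.
- by apply: measurable_funX; exact: measurable_snd.
Qed.

Lemma leb2X (A B : set (measurableTypeR R)) :
  measurable A -> measurable B -> leb2 (A `*` B) = (leb1 A * leb1 B)%E.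
Proof. exact: product_measure1E. Qed.

Definition area : R := fine (leb2 disk).

Lemma area_fin_gt0 : leb2 disk \is a fin_num /\ 0 < area.
Proof.
have le_disk : (leb2 disk <= 4%:E)%E.
  have -> : 4%:E = leb2 (`[-1, 1] `*` `[-1, 1]).
    rewrite leb2X; [|exact: measurable_itv..].
    rewrite /leb1 /= !lebesgue_measure_itv/= lte_fin gtrN// ?ltr01//.
    by rewrite -EFinD -EFinM opprK -[1 + 1]/(2%:R) -natrM.
  apply: le_measure; rewrite ?inE.
  - exact: measurable_disk.
  - by apply: measurableX; exact: measurable_itv.
  move=> [a b]; rewrite /disk/= /radius/= -[X in _ <= X]sqrtr1 ler_sqrt// => h.
  have sq (u v : R) : u ^+ 2 + v ^+ 2 <= 1 -> -1 <= u <= 1.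
    move=> uv; rewrite -ler_norml -(ler_pXn2r (n := 2))// ?nnegrE//.
    rewrite real_normK ?num_real// expr1n (le_trans _ uv)//.
    by rewrite lerDl sqr_ge0.
  by split; rewrite in_itv/=; [exact: sq h|rewrite addrC in h; exact: sq h].
have ge_disk : ((2^-1 * 2^-1)%:E <= leb2 disk)%E.
  have -> : (2^-1 * 2^-1)%:E = leb2 (`[0, 2^-1] `*` `[0, 2^-1]).
    rewrite leb2X; [|exact: measurable_itv..].
    rewrite /leb1 /= !lebesgue_measure_itv/= lte_fin.
    by rewrite invr_gt0// ltr0n/= -EFinD subr0.
  apply: le_measure; rewrite ?inE.
  - by apply: measurableX; exact: measurable_itv.
  - exact: measurable_disk.
  move=> [a b] []/=; rewrite /disk/= /radius/= -[X in _ <= X]sqrtr1 ler_sqrt//.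
  rewrite !in_itv/= => /andP[a0 a1] /andP[b0 b1].
  have sq (u : R) : 0 <= u -> u <= 2^-1 -> u ^+ 2 <= 2^-1.
    move=> u0 u1; rewrite expr2 (le_trans (ler_pM u0 u0 u1 u1))//.
    by rewrite ler_piMr// ?invr_ge0// invf_le1// ler1n.
  by rewrite [leRHS](splitr 1) !mul1r lerD// sq.
have fin : leb2 disk \is a fin_num.
  by rewrite ge0_fin_numE// (le_lt_trans le_disk)// ltry.
split=> //; rewrite /area fine_gt0// (lt_le_trans _ ge_disk)/=.
  by rewrite (le_lt_trans le_disk)// ltry.
by rewrite lte_fin mulr_gt0// invr_gt0.
Qed.

Definition circle_param (t : measurableTypeR R) : plane R := (cos t, sin t).

Lemma measurable_circle_param : measurable_fun setT circle_param.
Proof.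
by apply/measurable_fun_pairP; split;
  apply: continuous_measurable_fun; [exact: continuous_cos|exact: continuous_sin].
Qed.

Lemma measurable_period : measurable (`[0, 2 * pi[ : set (measurableTypeR R)).
Proof. exact: measurable_itv. Qed.

(* [circle_param] has unit speed and is injective on [0, 2 pi[. *)
Definition arc_length : set (plane R) -> \bar R :=
  pushforward (mrestr leb1 measurable_period) circle_param.

Let arc_length0 : arc_length set0 = 0%E.
Proof. by rewrite /arc_length /pushforward preimage_set0 measure0. Qed.

Let arc_length_ge0 A : (0 <= arc_length A)%E.
Proof. exact: (measure_ge0 (mrestr leb1 measurable_period)). Qed.

Let arc_length_sigma_additive : semi_sigma_additive arc_length.
Proof.
pose m := pushforward (mrestr leb1 measurable_period) circle_param
  : {measure set (plane R) -> \bar R}.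
exact: (@measure_semi_sigma_additive _ _ _ (m measurable_circle_param)).
Qed.

HB.instance Definition _ := isMeasure.Build _ _ _ arc_length
  arc_length0 arc_length_ge0 arc_length_sigma_additive.

Definition perimeter : R := fine (arc_length setT).

Lemma arc_lengthT : arc_length setT = (2 * pi)%:E.
Proof.
rewrite /arc_length /pushforward /mrestr preimage_setT setTI /leb1 /=.
rewrite lebesgue_measure_itv/= lte_fin mulr_gt0// ?pi_gt0//.
by rewrite -EFinD subr0.
Qed.

Lemma perimeterE : perimeter = 2 * pi.
Proof. by rewrite /perimeter arc_lengthT. Qed.

Let area_inv_ge0 : 0 <= area^-1.
Proof. by rewrite invr_ge0 ltW//; exact: area_fin_gt0.2. Qed.

Let perimeter_inv_ge0 : 0 <= perimeter^-1.
Proof. by rewrite invr_ge0 perimeterE mulr_ge0// pi_ge0. Qed.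

Definition disk_unif : {measure set (plane R) -> \bar R} :=
  mscale (NngNum area_inv_ge0) (mrestr leb2 measurable_disk).

Definition circle_unif : {measure set (plane R) -> \bar R} :=
  mscale (NngNum perimeter_inv_ge0) arc_length.

Definition disk_circle (alpha : {i01 R}) : set (plane R) -> \bar R :=
  measure_add (mscale (1 - alpha%:num)%:nng disk_unif)
              (mscale alpha%:num%:nng circle_unif).

HB.instance Definition _ alpha := Measure.on (disk_circle alpha).

Let disk_circleT alpha : disk_circle alpha setT = 1%E.
Proof.
rewrite /disk_circle measure_addE/= /mscale/= /disk_unif /circle_unif/=.
rewrite /mscale/= /mrestr setTI arc_lengthT perimeterE.
have [fin a0] := area_fin_gt0.
rewrite -[leb2 disk]fineK// -/area -!EFinM -EFinD !mulVf ?gt_eqF//.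
  by rewrite !mulr1 subrK.
by rewrite mulr_gt0// pi_gt0.
Qed.

HB.instance Definition _ alpha :=
  Measure_isProbability.Build _ _ _ (disk_circle alpha) (disk_circleT alpha).

End Measures.

Section Christoffel.
Context {R : realType}.
Implicit Types (nu : probability (plane R) R) (f g : plane R -> R[i]).

(* Functions on the disk are represented by functions on the plane whose values
   outside of the disk are ignored. *)
Definition span_on_disk m (e : 'I_m -> plane R -> R[i]) :
    set (plane R -> R[i]) :=
  [set f | exists c : 'I_m -> R[i],
     forall x, disk x -> f x = \sum_(i < m) c i * e i x].

Definition sq_norm (z : R[i]) : R := Normc.normc z ^+ 2.

Definition L2_disk nu : set (plane R -> R[i]) :=
  [set f | [/\ measurable_fun disk (fun x => complex.Re (f x)),
               measurable_fun disk (fun x => complex.Im (f x)) &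
               nu.-integrable disk (fun x => (sq_norm (f x))%:E)]].

Definition inner_disk nu f g : R[i] :=
  \int[nu]_(x in disk) complex.Re (f x * (g x)^*%C) +i*
  \int[nu]_(x in disk) complex.Im (f x * (g x)^*%C).

Definition orthonormal_basis nu m (V : set (plane R -> R[i]))
    (e : 'I_m -> plane R -> R[i]) : Prop :=
  [/\ forall i, V (e i),
      V `<=` span_on_disk e,
      forall i, L2_disk nu (e i) &
      forall i j, inner_disk nu (e i) (e j) = (i == j)%:R].

Definition sum_sq m (e : 'I_m -> plane R -> R[i]) (x : plane R) : R :=
  \sum_(i < m) sq_norm (e i x).

(* [is_K m V nu k] states that K(V, nu) is well-defined, for V of dimension m,
   and equal to k: an orthonormal basis exists, and for every orthonormal
   basis the maximum over the disk is attained and equals k. *)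
Definition is_K m (V : set (plane R -> R[i])) nu (k : R) : Prop :=
  (exists e : 'I_m -> plane R -> R[i], orthonormal_basis nu V e) /\
  forall e : 'I_m -> plane R -> R[i], orthonormal_basis nu V e ->
    (sum_sq e @` disk) k /\ ubound (sum_sq e @` disk) k.

Definition fourier_bessel_space (lam : R) (L : nat) : set (plane R -> R[i]) :=
  span_on_disk (fun i : 'I_(L.*2.+1) => fourier_bessel lam (i%:Z - L%:Z)).

End Christoffel.

(* Main.v *)
Require Import Defs.
From mathcomp Require Import all_boot all_order all_algebra.
From mathcomp Require Import all_classical all_reals all_analysis.
From mathcomp Require Import measurable_realfun complex zify ring lra.
Import Defs.

(** Write rho for the squared radius of a point x of the disk and kap for
    (lam / 2)^2.  Since J_n(y) = (y / 2)^n C_n((y / 2)^2) for an entire function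
    C_n ([clifford n]), the squared modulus of b_(lam, j) at x is
    Q_n(kap rho) with n = |j| and Q_n(w) = w^n C_n(w)^2 ([bessel_sqr n]).

    All the measures nu_alpha are invariant under rotations, and b_(lam, j) is
    multiplied by exp(i j phi) under the rotation of angle phi; choosing phi so
    that exp(i (j - k) phi) is not 1 shows that b_(lam, j) and b_(lam, k) are
    orthogonal.  Dividing each function by its norm gives an orthonormal basis,
    and two orthonormal bases differ by a unitary matrix, so that the sum of
    squares of any of them is the sum over |j| <= L of Q_|j|(kap rho) / N_|j|,
    where N_n is the integral of Q_n(kap rho).  It is a continuous function of
    rho in [0, 1], hence its maximum is attained ([is_K_fourier_bessel]).

    It remains to compare Q_n and N_n.  For large n the leading term of the
    power series dominates: n! C_n is 1 + O(1 / n), uniformly on [0, kap].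

    For the uniform measure, the mean of rho^n is at most 1 / (n + 1), so
    that N_n is at most about kap^n / (n!^2 (n + 1)) while Q_n(kap) is about
    kap^n / n!^2.  On the unit circle the n-th quotient is therefore of order
    n + 1, and the sum over -L <= j <= L is of order L^2, that is m^2 / 4.  With
    the crude bounds 3/4 and 5/4 for n! C_n the quotient is still at least
    9/25 (n + 1), which is enough for m^2 / 16 ([fb_christoffel_ge]).

    If the circle has mass alpha > 0, then N_n >= alpha Q_n(kap).  For large n
    the function Q_n increases on [0, kap], so that the n-th quotient is at
    most 1 / alpha on the whole disk; the finitely many remaining frequencies
    contribute a constant ([fb_christoffel_le]). *)

Set Implicit Arguments.
Unset Strict Implicit.
Unset Printing Implicit Defensive.

Import Order.TTheory GRing.Theory Num.Theory.
Import numFieldNormedType.Exports.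

Local Open Scope classical_set_scope.
Local Open Scope complex_scope.
Local Open Scope ring_scope.

(** * Bessel functions through the Bessel-Clifford series *)

Section BesselClifford.
Context {R : realType}.
Implicit Types (w x K r : R) (n k : nat).

Definition clifford_coeff n k : R := (-1) ^+ k / (k`!%:R * (k + n)`!%:R).

(** The Bessel-Clifford function of order n at - w.  Unlike J_n it is entire in
    the square of the radial variable, and differentiation only shifts n. *)
Definition clifford n w : R := limn (pseries (clifford_coeff n) w).

Lemma norm_clifford_coeff n k :
  `|clifford_coeff n k| = (k`!%:R * (k + n)`!%:R)^-1.
Proof.
rewrite /clifford_coeff normrM normrX normrN1 expr1n mul1r normfV.
by rewrite ger0_norm// mulr_ge0.
Qed.

Lemma is_cvg_clifford n w : cvgn (pseries (clifford_coeff n) w).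
Proof.
apply: normed_cvg.
apply: (@series_le_cvg _ _ (exp_coeff `|w|)) => [k|k|k|].
- exact: normr_ge0.
- exact: exp_coeff_ge0.
- rewrite /= normrM norm_clifford_coeff normrX /exp_coeff/= mulrC.
  rewrite ler_wpM2l ?exprn_ge0// lef_pV2 ?posrE ?mulr_gt0 ?ltr0n ?fact_gt0//.
  by rewrite ler_peMr ?ler1n ?fact_gt0.
- exact: is_cvg_series_exp_coeff.
Qed.

Lemma bessel_natE n x : bessel_nat n x = (x / 2) ^+ n * clifford n ((x / 2) ^+ 2).
Proof.
rewrite /bessel_nat /clifford /pseries -[RHS]/(_ *: _).
rewrite -lim_seriesZ; last exact: is_cvg_clifford.
congr (limn (series _)); apply/funext => k.
rewrite /bessel_coeff /clifford_coeff !fctE /GRing.scale/= exprD -mul2n exprM.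
by ring.
Qed.

(** The factor k + 1 produced by differentiation turns (k + 1)! into k!, while
    k + 1 + n is also k + (n + 1): only the order and the sign change. *)
Lemma pseries_diffs_clifford n :
  pseries_diffs (clifford_coeff n) = (fun k => - clifford_coeff n.+1 k).
Proof.
apply/funext => k; rewrite /pseries_diffs /clifford_coeff addSnnS (factS k).
rewrite natrM exprS; have /eqP k0 : k.+1%:R != 0 :> R by rewrite pnatr_eq0.
have fn0 (m : nat) : m`!%:R != 0 :> R by rewrite pnatr_eq0 gtn_eqF// fact_gt0.
by field; rewrite !fn0 addrC natr1; exact/eqP.
Qed.

Global Instance is_derive_clifford n w :
  is_derive w (1 : R) (clifford n) (- clifford n.+1 w).
Proof.
have cvgN m x : cvgn (pseries (fun k => - clifford_coeff m k) x).
  rewrite /pseries (_ : (fun k => _) = - (fun k => clifford_coeff m k * x ^+ k)).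
    by rewrite is_cvg_seriesN; exact: is_cvg_clifford.
  by apply/funext => k; rewrite !fctE mulNr.
rewrite (_ : - clifford n.+1 w = limn (pseries (pseries_diffs (clifford_coeff n)) w)).
  apply: (@pseries_snd_diffs _ _ (`|w| + 1)).
  - exact: is_cvg_clifford.
  - by rewrite pseries_diffs_clifford; exact: cvgN.
  - rewrite pseries_diffs_clifford pseries_diffsN pseries_diffs_clifford.
    rewrite (_ : - _ = clifford_coeff n.+2); first exact: is_cvg_clifford.
    by apply/funext => k; rewrite fctE opprK.
  - by rewrite [ltRHS]ger0_norm// ltrDl.
rewrite pseries_diffs_clifford /clifford -lim_seriesN; last exact: is_cvg_clifford.
congr (limn _); congr series; apply/funext => k /=; by rewrite mulNr.
Qed.

Lemma continuous_clifford n : continuous (clifford n).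
Proof.
move=> w; apply/differentiable_continuous/derivable1_diffP.
exact: ex_derive.
Qed.

(** Compared with the term of index k of the exponential series, the term of
    index k + 1 of n! C_n(w) has an additional factor at most w / (n + 1), since
    (n + k + 1)! >= n! (n + 1). *)
Lemma normr_clifford_sub n w : 0 <= w ->
  `|n`!%:R * clifford n w - 1| <= w * expR w / n.+1%:R.
Proof.
move=> w0.
rewrite mulrAC; set D : R := w / n.+1%:R.
have D0 : 0 <= D by rewrite divr_ge0.
suff S N : `|n`!%:R * pseries (clifford_coeff n) w N.+1 - 1| <= D * expR w.
  have C : `|n`!%:R * pseries (clifford_coeff n) w N - 1| @[N --> \oo] -->
      `|n`!%:R * clifford n w - 1|.
    apply: cvg_norm; apply: cvgB; last exact: cvg_cst.
    by apply: cvgMl_tmp; exact: is_cvg_clifford.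
  apply: (cvgr_to_le C); near=> N.
  have N0 : (0 < N)%N by near: N; exact: nbhs_infty_gt.
  by rewrite -(prednK N0).
have hn (k : nat) : `|n`!%:R * (clifford_coeff n k.+1 * w ^+ k.+1)| <=
    D * exp_coeff w k.
  rewrite normrM normrM norm_clifford_coeff normrX (ger0_norm w0) ger0_norm//.
  rewrite /exp_coeff/= /D exprS.
  have nk : (n`! * n.+1 <= (k.+1 + n)`!)%N.
    rewrite mulnC -factS addSnnS; elim: k => // k ih.
    by rewrite addSn factS (leq_trans ih)// leq_pmull.
  have kk : (k`! <= k.+1`!)%N by rewrite factS leq_pmull.
  rewrite [leLHS](_ : _ = (w * w ^+ k) * (n`!%:R / (k.+1`!%:R * (k.+1 + n)`!%:R))); last by ring.
  rewrite [leRHS](_ : _ = (w * w ^+ k) * (n.+1%:R * k`!%:R)^-1); last by rewrite invfM; ring.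
  rewrite ler_wpM2l ?mulr_ge0 ?exprn_ge0//.
  rewrite ler_pdivrMr ?mulr_gt0 ?ltr0n ?fact_gt0// mulrC.
  rewrite ler_pdivlMr ?mulr_gt0 ?ltr0n ?fact_gt0// -!natrM ler_nat.
  by rewrite mulnA (mulnC k.+1`!) leq_mul.
rewrite /pseries /series/= big_nat_recl// mulrDr.
rewrite {1}/clifford_coeff !expr0 fact0 !mul1r add0n mulr1 divff ?pnatr_eq0 ?gtn_eqF ?fact_gt0//.
rewrite addrAC subrr add0r mulr_sumr (le_trans (ler_norm_sum _ _ _))//.
apply: (@le_trans _ _ (D * series (exp_coeff w) N)).
  by rewrite /series/= mulr_sumr ler_sum.
rewrite ler_wpM2l// /expR.
apply: nondecreasing_cvgn_le; last exact: is_cvg_series_exp_coeff.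
by apply/nondecreasing_series => k _ _; exact: exp_coeff_ge0.
Unshelve. all: by end_near. Qed.

(** The lower bound on n makes the error in [normr_clifford_sub] at most 1/4 on
    the whole of [0, K]; it is the meaning of a large order from here on. *)
Lemma clifford_bounds n w K : 0 <= w <= K -> 4 * (K * expR K) <= n.+1%:R ->
  3 / 4 <= n`!%:R * clifford n w <= 5 / 4.
Proof.
move=> /andP[w0 wK] Kn; have := normr_clifford_sub n w0.
suff h1 : w * expR w / n.+1%:R <= 1 / 4.
  move=> /le_trans/(_ h1); rewrite ler_norml => /andP[h2 h3].
  by apply/andP; split; lra.
rewrite ler_pdivrMr ?ltr0n//.
have : w * expR w <= K * expR K by rewrite ler_pM ?expR_ge0 ?ler_expR.
lra.
Qed.

Lemma clifford_gt0 n w K : 0 <= w <= K -> 4 * (K * expR K) <= n.+1%:R ->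
  0 < clifford n w.
Proof.
move=> wK Kn; have /andP[h _] := clifford_bounds wK Kn.
rewrite -(pmulr_rgt0 _ (_ : 0 < n`!%:R)) ?ltr0n ?fact_gt0//.
by rewrite (lt_le_trans _ h)// divr_gt0.
Qed.

(** The function w C_n(w) has derivative C_n(w) - w C_(n+1)(w), which is
    nonnegative on [0, K]: there n! C_n is at least 3/4, while n! w C_(n+1) is at
    most 5/4 w / (n + 1), and K / (n + 1) is at most 1/4. *)
Lemma mulr_clifford_le n K r : 0 <= r <= 1 -> 4 * (K * expR K) <= n.+1%:R ->
  0 <= K -> r * clifford n (K * r) <= clifford n K.
Proof.
move=> /andP[r0 r1] Kn; rewrite le0r => /predU1P[->|K0].
  rewrite !mul0r ler_piMl// ltW// (clifford_gt0 (K := 0)) ?lexx//.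
  by rewrite mul0r mulr0.
pose F w : R := w * clifford n w.
have dF w : is_derive w (1 : R) F (clifford n w - w * clifford n.+1 w).
  have -> : clifford n w - w * clifford n.+1 w = w *: (- clifford n.+1 w) + clifford n w *: 1.
    by rewrite /GRing.scale/= mulrN addrC mulr1.
  exact: is_deriveM.
suff h : F (K * r) <= F K by rewrite -(ler_pM2l K0) mulrA.
apply: (@ger0_derive1_ndecr _ F 0 K) => //.
- move=> w; rewrite in_itv/= => /andP[w0 wK].
  rewrite derive1E derive_val.
  have wK' : 0 <= w <= K by rewrite !ltW.
  have /andP[h _] := clifford_bounds wK' Kn.
  have Kn1 : 4 * (K * expR K) <= n.+2%:R.
    by rewrite (le_trans Kn)// ler_nat.
  have /andP[_ h'] := clifford_bounds wK' Kn1.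
  have f0 : 0 < n`!%:R :> R by rewrite ltr0n fact_gt0.
  rewrite -(pmulr_rge0 _ f0) mulrBr subr_ge0 (le_trans _ h)//.
  rewrite mulrCA -[_ * clifford _ _](@mulKf _ n.+1%:R) ?pnatr_eq0//.
  rewrite (mulrA n.+1%:R) -natrM -factS mulrCA ler_pdivrMl//.
  move: h'; set u := _ * clifford _ _ => h'.
  have KK : K <= K * expR K by rewrite ler_peMr ?expR_ge1 ?(ltW K0)// -expR0 ler_expR ltW.
  have : w * u <= w * (5 / 4) by rewrite ler_wpM2l// ltW.
  lra.
- by apply: continuous_subspaceT => w; apply/differentiable_continuous/derivable1_diffP.
- by rewrite mulr_ge0// ltW.
- by rewrite ger_pMr.
Qed.

(** J_n(2 sqrt w)^2: the squared modulus of a Fourier-Bessel function, in terms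
    of the square of half its radial variable. *)
Definition bessel_sqr n w : R := w ^+ n * clifford n w ^+ 2.

Lemma bessel_sqr_ge0 n w : 0 <= w -> 0 <= bessel_sqr n w.
Proof. by move=> w0; rewrite mulr_ge0 ?sqr_ge0 ?exprn_ge0. Qed.

Lemma continuous_bessel_sqr n : continuous (bessel_sqr n).
Proof.
move=> w; apply: cvgM; first exact: exprn_continuous.
rewrite /GRing.exp/=.
by apply: cvgM; exact: continuous_clifford.
Qed.

(** Two of the n factors r suffice to reduce to [mulr_clifford_le]. *)
Lemma bessel_sqr_le n K r : 0 <= r <= 1 -> 0 <= K -> (2 <= n)%N ->
  4 * (K * expR K) <= n.+1%:R -> bessel_sqr n (K * r) <= bessel_sqr n K.
Proof.
move=> r01 K0 n2 Kn; have /andP[r0 r1] := r01.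
rewrite /bessel_sqr exprMn -mulrA ler_wpM2l ?exprn_ge0//.
have wK : 0 <= K * r <= K by rewrite mulr_ge0//= ler_piMr.
apply: (@le_trans _ _ ((r * clifford n (K * r)) ^+ 2)).
  by rewrite exprMn ler_wpM2r ?sqr_ge0// ler_wiXn2l.
have c0 := clifford_gt0 wK Kn.
rewrite ler_pXn2r ?nnegrE ?mulr_clifford_le//.
  by rewrite mulr_ge0// ltW.
by rewrite ltW// (clifford_gt0 _ Kn)// lexx K0.
Qed.

Lemma bessel_sqr_ge n K : 0 <= K -> 4 * (K * expR K) <= n.+1%:R ->
  9 / 16 * (K ^+ n / n`!%:R ^+ 2) <= bessel_sqr n K.
Proof.
move=> K0 Kn; have KK : 0 <= K <= K by rewrite K0 lexx.
have /andP[h _] := clifford_bounds KK Kn.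
have f0 : 0 < n`!%:R :> R by rewrite ltr0n fact_gt0.
rewrite /bessel_sqr mulrCA ler_wpM2l ?exprn_ge0// ler_pdivrMr ?exprn_gt0//.
rewrite [leRHS]mulrC -exprMn (_ : 9 / 16 = (3 / 4) ^+ 2); last by field.
by rewrite ler_pXn2r ?nnegrE// (le_trans _ h).
Qed.

Lemma bessel_sqr_le_pow n K r : 0 <= r <= 1 -> 0 <= K ->
  4 * (K * expR K) <= n.+1%:R ->
  bessel_sqr n (K * r) <= 25 / 16 * (K ^+ n / n`!%:R ^+ 2) * r ^+ n.
Proof.
move=> /andP[r0 r1] K0 Kn.
have wK : 0 <= K * r <= K by rewrite mulr_ge0//= ler_piMr.
have /andP[_ h] := clifford_bounds wK Kn.
have f0 : 0 < n`!%:R :> R by rewrite ltr0n fact_gt0.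
rewrite /bessel_sqr exprMn.
rewrite [leRHS](_ : _ = K ^+ n * r ^+ n * (25 / 16 / n`!%:R ^+ 2)); last by ring.
rewrite ler_wpM2l ?mulr_ge0 ?exprn_ge0// ler_pdivlMr ?exprn_gt0//.
rewrite mulrC -exprMn (_ : 25 / 16 = (5 / 4) ^+ 2); last by field.
have c0 := clifford_gt0 wK Kn.
by rewrite ler_pXn2r ?nnegrE// ?mulr_ge0// ltW.
Qed.

(** The leading term of the series of a low order need not dominate on the whole
    disk, but it does near the origin; there no squared function vanishes, hence
    all the norms are positive. *)
Lemma bessel_sqr_near0 n K : 0 < K ->
  exists e c : R, [/\ 0 < e, e <= 1, 0 < c &
    forall r, e / 2 <= r <= e -> c <= bessel_sqr n (K * r)].
Proof.
(* This e is at most 1 and makes K e at most 1/8. *)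
move=> K0; pose e : R := (8 * K + 1)^-1.
have e0 : 0 < e by rewrite invr_gt0; lra.
have f0 : 0 < n`!%:R :> R by rewrite ltr0n fact_gt0.
pose c : R := (K * (e / 2)) ^+ n * ((2 * n`!%:R)^-1) ^+ 2.
exists e, c; split => //.
- by rewrite invf_le1; lra.
- by rewrite /c mulr_gt0// exprn_gt0// ?invr_gt0 ?mulr_gt0// divr_gt0.
move=> r /andP[re er]; rewrite /c /bessel_sqr.
have r0 : 0 <= r by rewrite (le_trans _ re)// divr_ge0// ltW.
apply: ler_pM; rewrite ?exprn_ge0// ?invr_ge0 ?mulr_ge0 ?divr_ge0// ?(ltW K0) ?(ltW e0) ?(ltW f0)//.
  by rewrite lerXn2r ?nnegrE ?mulr_ge0 ?divr_ge0 ?(ltW K0) ?(ltW e0) ?ler_pM2l.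
have w0 : 0 <= K * r by rewrite mulr_ge0 // ltW.
have w8 : K * r <= 1 / 8.
  have : K * r <= K * e by rewrite ler_pM2l.
  have : K * e <= 1 / 8.
    by rewrite /e ler_pdivrMr; lra.
  lra.
have := normr_clifford_sub n w0.
have e3 : expR (K * r) <= 3.
  have h1 := expR_ge1Dx (- (K * r)); have h2 := expR_gt0 (K * r).
  have h3 : expR (K * r) * expR (- (K * r)) = 1 by rewrite -expRD subrr expR0.
  have : expR (K * r) * (7 / 8) <= expR (K * r) * expR (- (K * r)).
    by rewrite ler_pM2l//; lra.
  lra.
have : K * r * expR (K * r) / n.+1%:R <= 1 / 2.
  rewrite ler_pdivrMr ?ltr0n//.
  have : K * r * expR (K * r) <= 1 / 8 * 3 by rewrite ler_pM ?expR_ge0.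
  have : 1 <= n.+1%:R :> R by rewrite ler1n.
  lra.
move=> h1 /le_trans/(_ h1); rewrite ler_norml => /andP[h _].
rewrite ler_pXn2r ?nnegrE ?invr_ge0 ?mulr_ge0 ?(ltW f0)//; last first.
  by rewrite -(pmulr_rge0 _ f0); lra.
rewrite invfM ler_pdivrMr// mulrC; lra.
Qed.

End BesselClifford.

(** * Linear changes of variables in the plane *)

Section AffineMaps.
Context {R : realType}.
Local Notation mR := (measurableTypeR R).

Definition affine (a b : R) (y : mR) : mR := a * y + b.

Lemma measurable_affine a b : measurable_fun setT (affine a b).
Proof.
by apply: measurable_funD => //; apply: measurable_funM.
Qed.

(** After multiplication by a, the left-hand side is a measure of A that agrees
    with Lebesgue measure on half-open intervals. *)
Lemma leb1_affine (a b : R) (A : set mR) : 0 < a -> measurable A ->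
  leb1 (affine a b @^-1` A) = (a^-1%:E * leb1 A)%E.
Proof.
move=> a0 mA.
have a'0 : 0 <= a by exact: ltW.
pose push : {measure set mR -> \bar R} := pushforward leb1 (affine a b).
pose mpush := push (measurable_affine a b).
pose m : {measure set mR -> \bar R} := mscale (NngNum a'0) mpush.
have : lebesgue_measure A = m A.
  apply: lebesgue_measure_unique mA => _ [[c d]] _ <-.
  rewrite -[m _]/(a%:E * leb1 (affine a b @^-1` `]c, d]%classic))%E.
  have E : affine a b @^-1` `]c, d]%classic = `](c - b) / a, (d - b) / a]%classic.
    apply/seteqP; split => y; rewrite /affine/= !in_itv/=;
    by rewrite ltr_pdivrMr// ler_pdivlMr// ltrBlDr lerBrDr mulrC.
  rewrite E /leb1 /= !lebesgue_measure_itv/= !lte_fin.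
  rewrite ltr_pM2r ?invr_gt0// ltrD2r; case: ifPn => _; last by rewrite mule0.
  by rewrite -!EFinD -EFinM; congr EFin; field; rewrite gt_eqF.
rewrite -[m _]/(a%:E * leb1 (affine a b @^-1` A))%E -/leb1 /leb1/= => ->.
by rewrite muleA -EFinM mulVf ?gt_eqF// mul1e.
Qed.

(** Triangular maps, on which the definition of the product measure by
    sections reduces to the one-dimensional case.  Rotations and dilations are
    products of a vertical and a horizontal one. *)
Definition vmap (a b : R) (x : plane R) : plane R := (x.1, a * x.2 + b * x.1).
Definition hmap (a b : R) (x : plane R) : plane R := (a * x.1 + b * x.2, x.2).

Lemma measurable_hmap a b : measurable_fun setT (hmap a b).
Proof.
apply/measurable_fun_pairP; split; last exact: measurable_snd.
by apply: measurable_funD; apply: measurable_funM.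
Qed.

(** The vertical section at u of the preimage is the preimage of the section
    under an affine map of slope a. *)
Lemma leb2_vmap a b (A : set (plane R)) : 0 < a -> measurable A ->
  leb2 (vmap a b @^-1` A) = (a^-1%:E * leb2 A)%E.
Proof.
move=> a0 mA; rewrite /leb2 /= /product_measure1.
rewrite -ge0_integralZl//; last 2 first.
  exact: measurable_fun_xsection.
  by rewrite lee_fin invr_ge0 ltW.
apply: eq_integral => x _ /=.
rewrite -(leb1_affine (b * x) a0); last exact: measurable_xsection.
by congr (leb1 _); apply/seteqP; split => y; rewrite /xsection/= !inE.
Qed.

Lemma measurable_preimageT (f : plane R -> plane R) (A : set (plane R)) :
  measurable_fun setT f -> measurable A -> measurable (f @^-1` A).
Proof. by move=> mf mA; rewrite -[X in measurable X]setTI; exact: mf. Qed.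

Definition swap2 (x : plane R) : plane R := (x.2, x.1).

Lemma measurable_swap2 : measurable_fun setT swap2.
Proof.
by apply/measurable_fun_pairP; split;[exact: measurable_snd|exact: measurable_fst].
Qed.

(** The product of two copies of one measure is determined by its values on
    rectangles, which are symmetric. *)
Lemma leb2_swap (A : set (plane R)) : measurable A ->
  leb2 (swap2 @^-1` A) = leb2 A.
Proof.
move=> mA; apply/esym.
pose push : {measure set (plane R) -> \bar R} := pushforward leb2 swap2.
apply: (product_measure_unique (m' := push measurable_swap2)) => // B C mB mC.
rewrite /push/= /pushforward muleC -leb2X//; congr (leb2 _).
by apply/seteqP; split => -[x y] [] /= *; split.
Qed.

Lemma leb2_hmap a b (A : set (plane R)) : 0 < a -> measurable A ->
  leb2 (hmap a b @^-1` A) = (a^-1%:E * leb2 A)%E.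
Proof.
move=> a0 mA.
rewrite -(leb2_swap mA) -(leb2_vmap b a0); last first.
  exact: measurable_preimageT measurable_swap2 mA.
by rewrite -leb2_swap//; exact: measurable_preimageT (measurable_hmap a b) mA.
Qed.

End AffineMaps.

(** * Rotations, dilations and the measures on the disk *)

Section Rotations.
Context {R : realType}.
Local Notation mR := (measurableTypeR R).
Implicit Types (phi s : R) (A : set (plane R)) (x : plane R).

Definition sqrad x : R := x.1 ^+ 2 + x.2 ^+ 2.

Lemma sqrad_ge0 x : 0 <= sqrad x.
Proof. by rewrite addr_ge0 ?sqr_ge0. Qed.

Lemma sqr_radius x : radius x ^+ 2 = sqrad x.
Proof. by rewrite sqr_sqrtr ?sqrad_ge0. Qed.

Lemma diskE x : disk x <-> sqrad x <= 1.
Proof.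
rewrite /disk/= -sqr_radius -[X in (radius x) ^+ 2 <= X](expr1n _ 2).
by rewrite ler_pXn2r ?nnegrE ?sqrtr_ge0.
Qed.

Lemma measurable_sqrad : measurable_fun setT (sqrad : plane R -> mR).
Proof.
by apply: measurable_funD; apply: measurable_funX;
  [exact: measurable_fst|exact: measurable_snd].
Qed.

Definition rot phi x : plane R :=
  (cos phi * x.1 - sin phi * x.2, sin phi * x.1 + cos phi * x.2).

Lemma sqrad_rot phi x : sqrad (rot phi x) = sqrad x.
Proof.
rewrite /sqrad/=.
have -> : (cos phi * x.1 - sin phi * x.2) ^+ 2 +
    (sin phi * x.1 + cos phi * x.2) ^+ 2 =
    (cos phi ^+ 2 + sin phi ^+ 2) * (x.1 ^+ 2 + x.2 ^+ 2) by ring.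
by rewrite cos2Dsin2 mul1r.
Qed.

Lemma disk_rot phi x : disk (rot phi x) <-> disk x.
Proof. by rewrite !diskE sqrad_rot. Qed.

(** The LU factorization of a rotation matrix, with pivot cos phi. *)
Lemma rotE phi x : 0 < cos phi ->
  rot phi x = hmap (cos phi)^-1 (- (sin phi / cos phi)) (vmap (cos phi) (sin phi) x).
Proof.
move=> c0; rewrite /rot /hmap /vmap/=; congr pair; last by rewrite addrC.
have := cos2Dsin2 phi; set c := cos phi in c0 *; set s := sin phi => cs.
have c0' : c != 0 by rewrite gt_eqF.
rewrite [LHS](_ : _ = (c ^+ 2 * x.1 - c * s * x.2) / c); last by field.
by rewrite (_ : c ^+ 2 = 1 - s ^+ 2); [field|rewrite -cs addrK].
Qed.

Lemma measurable_rot phi : measurable_fun setT (rot phi).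
Proof.
apply/measurable_fun_pairP; split.
  apply: measurable_funB; apply: measurable_funM => //.
by apply: measurable_funD; apply: measurable_funM.
Qed.

Lemma leb2_rot phi A : 0 < cos phi -> measurable A ->
  leb2 (rot phi @^-1` A) = leb2 A.
Proof.
move=> c0 mA.
have -> : rot phi @^-1` A = vmap (cos phi) (sin phi) @^-1`
    (hmap (cos phi)^-1 (- (sin phi / cos phi)) @^-1` A).
  by apply/seteqP; split => x /=; rewrite rotE.
rewrite leb2_vmap//; last exact: measurable_preimageT (measurable_hmap _ _) mA.
rewrite leb2_hmap ?invr_gt0// invrK muleA -EFinM mulVf ?gt_eqF//.
by rewrite mul1e.
Qed.

Definition dil (q : R) x : plane R := (q * x.1, q * x.2).

Lemma measurable_dil q : measurable_fun setT (dil q).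
Proof. by apply/measurable_fun_pairP; split; apply: measurable_funM. Qed.

Lemma sqrad_dil q x : sqrad (dil q x) = q ^+ 2 * sqrad x.
Proof. by rewrite /sqrad/=; ring. Qed.

Lemma leb2_dil (q : R) A : 0 < q -> measurable A ->
  leb2 (dil q @^-1` A) = ((q ^- 2)%:E * leb2 A)%E.
Proof.
move=> q0 mA.
have -> : dil q @^-1` A = vmap q 0 @^-1` (hmap q 0 @^-1` A).
  by apply/seteqP; split => x /=; rewrite /hmap /vmap/= !mul0r !addr0.
rewrite leb2_vmap//; last exact: measurable_preimageT (measurable_hmap _ _) mA.
by rewrite leb2_hmap// muleA -EFinM -expr2 exprVn.
Qed.

Lemma measurable_preimage_sqrad (B : set mR) : measurable B ->
  measurable ((sqrad : plane R -> mR) @^-1` B).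
Proof.
by move=> mB; rewrite -[X in measurable X]setTI; exact: measurable_sqrad.
Qed.

Lemma measurable_sqrad_le s : measurable [set x | sqrad x <= s].
Proof.
have -> : [set x | sqrad x <= s] = (sqrad : plane R -> mR) @^-1` `]-oo, s].
  by apply/seteqP; split => x; rewrite /= in_itv.
by apply: measurable_preimage_sqrad; exact: measurable_itv.
Qed.

Lemma measurable_annulus (a b : R) : measurable [set x | a <= sqrad x <= b].
Proof.
have -> : [set x | a <= sqrad x <= b] = (sqrad : plane R -> mR) @^-1` `[a, b].
  by apply/seteqP; split => x; rewrite /= in_itv.
by apply: measurable_preimage_sqrad; exact: measurable_itv.
Qed.

Lemma leb2_sqrad_le s : 0 < s -> leb2 [set x | sqrad x <= s] = (s * area)%:E.
Proof.
move=> s0; have r0 : 0 < Num.sqrt s by rewrite sqrtr_gt0.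
have E : [set x | sqrad x <= s] = dil (Num.sqrt s)^-1 @^-1` disk.
  apply/seteqP; split => x /=; rewrite -/(disk _) diskE sqrad_dil exprVn;
  by rewrite sqr_sqrtr ?(ltW s0)// ler_pdivrMl// mulr1.
rewrite E leb2_dil ?invr_gt0//; last exact: measurable_disk.
rewrite exprVn invrK sqr_sqrtr ?(ltW s0)// EFinM /area fineK//.
by have [] := @area_fin_gt0 R.
Qed.

Let circle_param_periodic (t : mR) : circle_param (t + 2 * pi) = circle_param t.
Proof.
by rewrite /circle_param (_ : 2 * pi = pi *+ 2 :> R) ?cosD2pi ?sinD2pi// mulr_natl.
Qed.

Let circle_param_rot phi (t : mR) :
  rot phi (circle_param t) = circle_param (t + phi).
Proof.
by rewrite addrC /rot /circle_param/= cosD sinD.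
Qed.

Let measurable_circle_preimage A : measurable A -> measurable (circle_param @^-1` A).
Proof.
by move=> mA; rewrite -[X in measurable X]setTI; exact: measurable_circle_param.
Qed.

Let leb1_translate (b : R) (B : set mR) : measurable B ->
  leb1 (affine 1 b @^-1` B) = leb1 B.
Proof. by move=> mB; rewrite leb1_affine// invr1 mul1e. Qed.

Let measureIU (B : set mR) (a b c : R) : measurable B -> a <= b <= c ->
  leb1 (B `&` `[a, c[) = (leb1 (B `&` `[a, b[) + leb1 (B `&` `[b, c[))%E.
Proof.
move=> mB /andP[ab bc].
rewrite -measureU.
- rewrite -setIUr; congr (leb1 (_ `&` _)).
  by rewrite -(@itv_bndbnd_setU _ _ _ (BLeft b)) ?bnd_simp.
- by apply: measurableI => //; exact: measurable_itv.
- by apply: measurableI => //; exact: measurable_itv.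
- apply/seteqP; split => // t [[_ /=]]; rewrite in_itv/= => /andP[_ tb] [_ /=].
  by rewrite in_itv/= leNgt tb.
Qed.

(** On the angular variable a rotation is a translation by phi; it maps the
    period [0, 2 pi[ to [phi, 2 pi + phi[, whose part above 2 pi is brought back
    to [0, phi[ by periodicity. *)
Lemma arc_length_rot phi A : 0 <= phi <= 2 * pi -> measurable A ->
  arc_length (rot phi @^-1` A) = arc_length A.
Proof.
move=> phi2 mA; rewrite /arc_length /pushforward /mrestr.
have /andP[phi0 phi2pi] := phi2.
set B := circle_param @^-1` A.
have mB : measurable B by exact: measurable_circle_preimage.
have mI (a b : R) : measurable (B `&` `[a, b[).
  by apply: measurableI => //; exact: measurable_itv.
transitivity (leb1 (B `&` `[phi, 2 * pi + phi[)).
  rewrite -[RHS](leb1_translate phi) //; congr (leb1 _); apply/seteqP; split => t /=;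
  rewrite !in_itv/= /B/= circle_param_rot /affine mul1r;
  by rewrite lerDr ltrD2r.
rewrite (@measureIU B phi (2 * pi))//; last by rewrite phi2pi lerDl.
rewrite (@measureIU B 0 phi)// addeC; congr (_ + _)%E.
rewrite -[LHS](leb1_translate (2 * pi)) //; congr (leb1 _); apply/seteqP; split => t /=;
rewrite !in_itv/= /B/= /affine mul1r circle_param_periodic;
by rewrite lerDr addrC ltrD2l.
Qed.

Lemma disk_circleE (alpha : {i01 R}) A :
  disk_circle alpha A = (((1 - alpha%:num) / area)%:E * leb2 (A `&` disk) +
    (alpha%:num / (perimeter : R))%:E * arc_length A)%E.
Proof.
rewrite /disk_circle measure_addE/= /mscale/= /disk_unif /circle_unif/= /mscale/=.
by rewrite !muleA -!EFinM.
Qed.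

Lemma disk_circle_rot (alpha : {i01 R}) phi A :
  0 < cos phi -> 0 <= phi <= 2 * pi -> measurable A ->
  disk_circle alpha (rot phi @^-1` A) = disk_circle alpha A.
Proof.
move=> c0 phi2 mA.
have E : rot phi @^-1` A `&` disk = rot phi @^-1` (A `&` disk).
  by apply/seteqP; split => x [/= xA xd]; split => //; apply/(disk_rot phi).
have mAd : measurable (A `&` disk) by apply: measurableI => //; exact: measurable_disk.
rewrite disk_circleE E (leb2_rot c0 mAd) (arc_length_rot phi2 mA).
by rewrite disk_circleE.
Qed.

Lemma disk_circle_circle (alpha : {i01 R}) :
  (alpha%:num%:E <= disk_circle alpha [set x | sqrad x = 1%R])%E.
Proof.
rewrite disk_circleE.
have -> : arc_length [set x : plane R | sqrad x = 1] = arc_length setT.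
  rewrite /arc_length /pushforward; congr (mrestr _ _ _).
  by apply/seteqP; split => t // _; rewrite /= /sqrad/= cos2Dsin2.
rewrite arc_lengthT perimeterE -EFinM divfK ?gt_eqF ?mulr_gt0 ?pi_gt0//.
rewrite leeDr// mule_ge0// lee_fin divr_ge0// ?subr_ge0//.
by rewrite ltW//; exact: area_fin_gt0.2.
Qed.

(** The uniform part alone gives this bound, which makes the norms positive. *)
Lemma disk_circle_annulus (alpha : {i01 R}) s : alpha%:num < 1 -> 0 < s <= 1 ->
  (((1 - alpha%:num) * (s / 2))%:E <=
    disk_circle alpha [set x | s / 2 <= sqrad x <= s]%R)%E.
Proof.
move=> a1 /andP[s0 s1].
have a0 : 0 < (area : R) by exact: area_fin_gt0.2.
rewrite disk_circleE.
apply: (@le_trans _ _ (((1 - alpha%:num) / area)%:E *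
   leb2 ([set x | s / 2 <= sqrad x <= s]%R `&` disk))%E); last first.
  rewrite leeDl// mule_ge0// lee_fin divr_ge0// perimeterE.
  by rewrite mulr_ge0// pi_ge0.
have E : leb2 ([set x | sqrad x <= s] `\` [set x | sqrad x <= s / 2]) =
    (s / 2 * area)%:E.
  have s20 : 0 < s / 2 by rewrite divr_gt0.
  have e1 := leb2_sqrad_le s0; have e2 := leb2_sqrad_le s20.
  have fs : (leb2 [set x | (sqrad x <= s)%R] < +oo)%E by rewrite e1 ltry.
  have := measureD (measurable_sqrad_le s) (measurable_sqrad_le (s / 2)) fs.
  rewrite setIidr; last first.
    by move=> x /= /le_trans -> //; rewrite ler_pdivrMr//; lra.
  move=> ->; transitivity ((s * area)%:E - (s / 2 * area)%:E : \bar R)%E.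
    by congr (_ - _)%E.
  by rewrite -EFinB; congr EFin; field.
apply: (@le_trans _ _ (((1 - alpha%:num) / area)%:E * (s / 2 * area)%:E)%E).
  by rewrite -EFinM lee_fin le_eqVlt; apply/orP; left; apply/eqP; field; rewrite gt_eqF.
rewrite lee_wpmul2l ?lee_fin ?divr_ge0 ?subr_ge0 ?(ltW a1) ?(ltW a0)// -E.
apply: le_measure; rewrite ?inE.
- by apply: measurableD; exact: measurable_sqrad_le.
- by apply: measurableI; [exact: measurable_annulus|exact: measurable_disk].
- move=> x [/= xs /negP]; rewrite -ltNge => /ltW xs'; split => /=.
    by rewrite xs'.
  by apply/diskE; rewrite (le_trans xs).
Qed.

End Rotations.

(** * Moments of the squared radius *)

Section Moments.
Context {R : realType}.
Local Notation mR := (measurableTypeR R).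
Implicit Types (q s : R).

Let powf n (x : plane R) : \bar R := (sqrad x ^+ n)%:E.

Let measurable_powf n (D : set (plane R)) : measurable_fun D (powf n).
Proof.
apply/measurable_EFinP/measurable_funTS/measurable_funX; exact: measurable_sqrad.
Qed.

Let powf_ge0 n x : (0 <= powf n x)%E.
Proof. by rewrite lee_fin exprn_ge0// sqrad_ge0. Qed.

Let integral_powf_fin n : (\int[leb2]_(x in disk) powf n x \is a fin_num)%E.
Proof.
rewrite ge0_fin_numE; last exact: integral_ge0.
apply: (@le_lt_trans _ _ (\int[leb2]_(x in (disk : set (plane R))) 1)%E).
  apply: ge0_le_integral => //; first exact: measurable_disk.
  by move=> x /diskE x1; rewrite lee_fin exprn_ile1// sqrad_ge0.
rewrite integral_cst ?mul1e; last exact: measurable_disk.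
by have [+ _] := @area_fin_gt0 R; rewrite ge0_fin_numE.
Qed.

(** Self-similarity: the dilation of ratio q multiplies areas by q^2 and the
    n-th power of the squared radius by q^(2n). *)
Let integral_powf_scale n q : 0 < q ->
  (\int[leb2]_(x in [set x | (sqrad x <= q ^+ 2)%R]) powf n x =
   (q ^+ 2 * (q ^+ 2) ^+ n)%:E * \int[leb2]_(x in disk) powf n x)%E.
Proof.
move=> q0.
pose push : {measure set (plane R) -> \bar R} := pushforward leb2 (dil q).
pose mpush := push (measurable_dil q).
have q20 : 0 <= q ^+ 2 by exact: sqr_ge0.
have E : dil q @^-1` [set x | (sqrad x <= q ^+ 2)%R] = disk.
  apply/seteqP; split => x /=; rewrite -/(disk _) diskE sqrad_dil;
  by rewrite ger_pMr ?exprn_gt0.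
have mS := measurable_sqrad_le (q ^+ 2).
rewrite (@eq_measure_integral _ _ _ _ (mscale (NngNum q20) mpush)); last first.
  move=> A mA _.
  rewrite -[RHS]/((q ^+ 2)%:E * leb2 (dil q @^-1` A))%E leb2_dil// muleA -EFinM.
  by rewrite divff ?mul1e// gt_eqF// exprn_gt0.
rewrite (ge0_integral_mscale _ mS _ (@measurable_powf n _) (fun x _ => powf_ge0 n x)).
have -> : (\int[mpush]_(x in [set x | (sqrad x <= q ^+ 2)%R]) powf n x =
    ((q ^+ 2) ^+ n)%:E * \int[leb2]_(x in disk) powf n x)%E.
  rewrite (ge0_integral_pushforward (measurable_dil q) _ mS
    (@measurable_powf n _) (fun x _ => powf_ge0 n x)).
  rewrite E -ge0_integralZl//; last 2 first.
    exact: measurable_disk.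
    by rewrite lee_fin exprn_ge0.
  by apply: eq_integral => x _; rewrite /powf/= sqrad_dil exprMn EFinM.
by rewrite muleA -EFinM.
Qed.

(** Let F be the integral.  The disk of radius q contributes q^(2n+2) F, and
    the rest at most its area (1 - q^2) |Omega|.  With p = q^2 this gives
    F (1 + p + ... + p^n) <= |Omega|, hence (n + 1) p^n F <= |Omega|, and p
    tends to 1. *)
Lemma leb2_sqrad_moment n :
  (\int[leb2]_(x in disk) (sqrad x ^+ n)%:E <= (area / n.+1%:R : R)%:E)%E.
Proof.
have F_fin := integral_powf_fin n.
have mdisk := @measurable_disk R.
have [_ area0] := @area_fin_gt0 R.
rewrite -(fineK F_fin) lee_fin ler_pdivlMr//.
set F := fine _; have F0 : 0 <= F by rewrite fine_ge0// integral_ge0.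
have self q : 0 < q < 1 ->
    F <= q ^+ 2 * (q ^+ 2) ^+ n * F + (1 - q ^+ 2) * area.
  move=> /andP[q0 q1]; have mS := measurable_sqrad_le (q ^+ 2).
  have mDS := measurableD mdisk mS.
  have q20 : 0 < q ^+ 2 by rewrite exprn_gt0.
  have q21 : q ^+ 2 <= 1 by rewrite exprn_ile1// ltW.
  have sub : [set x : plane R | (sqrad x <= q ^+ 2)%R] `<=` disk.
    by move=> x /= h; apply/diskE; exact: le_trans q21.
  rewrite -lee_fin EFinD EFinM /F !fineK//.
  rewrite [leLHS](_ : _ = (\int[leb2]_(x in [set x | (sqrad x <= q ^+ 2)%R]) powf n x +
      \int[leb2]_(x in disk `\` [set x | (sqrad x <= q ^+ 2)%R]) powf n x)%E); last first.
    rewrite -[in LHS](setDUK sub) ge0_integral_setU//.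
    by apply/disj_setPS => x [/= h [_ /(_ h)]].
  rewrite integral_powf_scale// leeD2l//.
  apply: (@le_trans _ _
      (\int[leb2]_(x in disk `\` [set x : plane R | (sqrad x <= q ^+ 2)%R]) 1)%E).
    apply: ge0_le_integral => //.
    by move=> x [/diskE x1 _]; rewrite lee_fin exprn_ile1// sqrad_ge0.
  rewrite integral_cst// mul1e.
  have fd : (leb2 (disk : set (plane R)) < +oo)%E.
    by have [+ _] := @area_fin_gt0 R; rewrite ge0_fin_numE.
  have := measureD mdisk mS fd; rewrite (setIidr sub) => ->.
  apply: (@le_trans _ _ ((area)%:E - (q ^+ 2 * area)%:E : \bar R)%E).
    apply: leeB; first by rewrite /area fineK//; have [] := @area_fin_gt0 R.
    rewrite le_eqVlt; apply/orP; left; apply/eqP/esym; exact: leb2_sqrad_le.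
  by rewrite -EFinB lee_fin mulrBl mul1r.
have bound p : 0 < p < 1 -> F * n.+1%:R * p ^+ n <= area.
  move=> /andP[p0 p1].
  have sp : 0 < Num.sqrt p < 1.
    by rewrite sqrtr_gt0 p0/= -sqrtr1 ltr_sqrt.
  have := self _ sp; rewrite sqr_sqrtr ?(ltW p0)// -exprS => h.
  have h1 : (1 - p) * (F * (\sum_(i < n.+1) p ^+ i)) <= (1 - p) * area.
    have geo : (1 - p) * (\sum_(i < n.+1) p ^+ i) = 1 - p ^+ n.+1.
      by rewrite -[RHS]opprB subrX1 -mulNr opprB.
    rewrite mulrCA geo mulrBr mulr1 [F * _]mulrC; lra.
  rewrite ler_pM2l ?subr_gt0// in h1.
  rewrite (le_trans _ h1)// -mulrA ler_wpM2l//.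
  rewrite mulr_natl -[X in _ *+ X]card_ord -sumr_const ler_sum// => i _.
  by rewrite ler_wiXn2l ?(ltW p0) ?(ltW p1)// -ltnS.
have C : F * n.+1%:R * p ^+ n @[p --> (1 : R)^'-] --> F * n.+1%:R.
  rewrite -[X in _ --> X]mulr1; apply: cvgMl_tmp.
  rewrite -[X in _ --> X](expr1n R n).
  by apply: cvg_at_left_filter; exact: exprn_continuous.
apply: (cvgr_to_le C); near=> p; apply: bound; apply/andP; split.
  by near: p; apply: nbhs_left_gt.
by near: p; exact: nbhs_left_lt.
Unshelve. all: by end_near. Qed.

Lemma disk_unif_sqrad_moment (alpha : {i01 R}) (n : nat) : alpha%:num = 0 ->
  (\int[disk_circle alpha]_(x in disk) (sqrad x ^+ n)%:E <= (n.+1%:R^-1 : R)%:E)%E.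
Proof.
move=> alpha0; have [_ area0] := @area_fin_gt0 R.
have a0 : 0 <= (area : R)^-1 by rewrite invr_ge0 ltW.
rewrite (@eq_measure_integral _ _ _ _ (mscale (NngNum a0) leb2)); last first.
  move=> A mA Ad; rewrite -[LHS]/(disk_circle _ A) disk_circleE (setIidl Ad).
  by rewrite alpha0 subr0 mul1r mul0r mul0e adde0.
rewrite (ge0_integral_mscale _ _ _ (@measurable_powf n _) (fun x _ => powf_ge0 n x)); last first.
  exact: measurable_disk.
apply: (@le_trans _ _ ((area : R)^-1%:E * (area / n.+1%:R : R)%:E)%E).
  by rewrite lee_wpmul2l ?lee_fin// leb2_sqrad_moment.
by rewrite -EFinM mulrA mulVf ?mul1r// gt_eqF.
Qed.

End Moments.

(** * Integrals of bounded complex-valued functions *)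

Section BoundedFunctions.
Context {R : realType}.
Implicit Types (g h : plane R -> R) (f : plane R -> R[i]).

(** A class of integrable functions on the disk that is stable under products.
    Measurability is required on the whole plane so that the class is also
    stable under composition with rotations. *)
Definition bounded_mfun g : Prop :=
  measurable_fun setT (g : plane R -> measurableTypeR R) /\
  exists M, forall x, disk x -> `|g x| <= M.

Lemma bounded_mfun_cst (r : R) : bounded_mfun (fun=> r).
Proof. by split => //; exists `|r|. Qed.

Lemma bounded_mfunD g h : bounded_mfun g -> bounded_mfun h ->
  bounded_mfun (fun x => g x + h x).
Proof.
move=> [mg [M gM]] [mh [N hN]]; split; first exact: measurable_funD.
by exists (M + N) => x dx; rewrite (le_trans (ler_normD _ _))// lerD ?gM ?hN.
Qed.

Lemma bounded_mfunM g h : bounded_mfun g -> bounded_mfun h ->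
  bounded_mfun (fun x => g x * h x).
Proof.
move=> [mg [M gM]] [mh [N hN]]; split; first exact: measurable_funM.
by exists (M * N) => x dx; rewrite normrM ler_pM ?gM ?hN.
Qed.

Lemma bounded_mfunN g : bounded_mfun g -> bounded_mfun (fun x => - g x).
Proof.
by move=> [mg [M gM]]; split; [exact: measurableT_comp|
  exists M => x dx; rewrite normrN gM].
Qed.

Lemma bounded_mfunB g h : bounded_mfun g -> bounded_mfun h ->
  bounded_mfun (fun x => g x - h x).
Proof. by move=> mg mh; apply: bounded_mfunD => //; exact: bounded_mfunN. Qed.

Definition bounded_cmfun f : Prop :=
  bounded_mfun (fun x => complex.Re (f x)) /\
  bounded_mfun (fun x => complex.Im (f x)).

Lemma bounded_cmfun_cst (c : R[i]) : bounded_cmfun (fun=> c).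
Proof. by split; exact: bounded_mfun_cst. Qed.

Lemma bounded_cmfun_real g : bounded_mfun g -> bounded_cmfun (fun x => (g x)%:C).
Proof. by move=> bg; split => //; exact: bounded_mfun_cst. Qed.

Let ReD (z w : R[i]) : complex.Re (z + w) = complex.Re z + complex.Re w.
Proof. by case: z w => ? ? []. Qed.
Let ImD (z w : R[i]) : complex.Im (z + w) = complex.Im z + complex.Im w.
Proof. by case: z w => ? ? []. Qed.
Let ReM (z w : R[i]) : complex.Re (z * w) =
  complex.Re z * complex.Re w - complex.Im z * complex.Im w.
Proof. by case: z w => ? ? []. Qed.
Let ImM (z w : R[i]) : complex.Im (z * w) =
  complex.Re z * complex.Im w + complex.Im z * complex.Re w.
Proof. by case: z w => ? ? []. Qed.

Lemma bounded_cmfunD f1 f2 : bounded_cmfun f1 -> bounded_cmfun f2 ->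
  bounded_cmfun (fun x => f1 x + f2 x).
Proof.
move=> [r1 i1] [r2 i2]; split.
  by under eq_fun do rewrite ReD; exact: bounded_mfunD.
by under eq_fun do rewrite ImD; exact: bounded_mfunD.
Qed.

Lemma bounded_cmfunM f1 f2 : bounded_cmfun f1 -> bounded_cmfun f2 ->
  bounded_cmfun (fun x => f1 x * f2 x).
Proof.
move=> [r1 i1] [r2 i2]; split.
  by under eq_fun do rewrite ReM; apply: bounded_mfunB; exact: bounded_mfunM.
by under eq_fun do rewrite ImM; apply: bounded_mfunD; exact: bounded_mfunM.
Qed.

Lemma bounded_cmfunJ f : bounded_cmfun f -> bounded_cmfun (fun x => (f x)^*%C).
Proof.
move=> [r i]; split.
  rewrite (_ : (fun x => _) = (fun x => complex.Re (f x)))//.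
  by apply/funext => x; case: (f x).
rewrite (_ : (fun x => _) = (fun x => - complex.Im (f x))).
  exact: bounded_mfunN.
by apply/funext => x; case: (f x).
Qed.

Lemma bounded_cmfunX f n : bounded_cmfun f -> bounded_cmfun (fun x => f x ^+ n).
Proof.
move=> bf; elim: n => [|n ih].
  by under eq_fun do rewrite expr0; exact: bounded_cmfun_cst.
by under eq_fun do rewrite exprS; exact: bounded_cmfunM.
Qed.

Lemma bounded_cmfun_sum m (F : 'I_m -> plane R -> R[i]) :
  (forall i, bounded_cmfun (F i)) -> bounded_cmfun (fun x => \sum_(i < m) F i x).
Proof.
elim: m F => [|m ih] F bF.
  by under eq_fun do rewrite big_ord0; exact: bounded_cmfun_cst.
by under eq_fun do rewrite big_ord_recr; apply: bounded_cmfunD => //; exact: ih.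
Qed.

End BoundedFunctions.

Section ComplexIntegral.
Context {R : realType} (nu : probability (plane R) R).
Implicit Types (g h : plane R -> R) (f : plane R -> R[i]).

Lemma bounded_mfun_integrable g : bounded_mfun g -> nu.-integrable disk (EFin \o g).
Proof.
move=> [mg [M gM]]; apply: measurable_bounded_integrable.
- exact: measurable_disk.
- by rewrite (le_lt_trans (probability_le1 _ _)) ?ltry//; exact: measurable_disk.
- exact: measurable_funTS.
- by exists M; split; [exact: num_real|move=> N MN x dx /=; rewrite (le_trans (gM x dx))// ltW].
Qed.

Definition cint f : R[i] :=
  \int[nu]_(x in disk) complex.Re (f x) +i* \int[nu]_(x in disk) complex.Im (f x).

Lemma inner_diskE f1 f2 : inner_disk nu f1 f2 = cint (fun x => f1 x * (f2 x)^*%C).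
Proof. by []. Qed.

Lemma eq_cint f1 f2 : (forall x, disk x -> f1 x = f2 x) -> cint f1 = cint f2.
Proof.
by move=> f12; congr Complex; apply: eq_Rintegral => x /[!inE] dx; rewrite f12.
Qed.

Lemma cintD f1 f2 : bounded_cmfun f1 -> bounded_cmfun f2 ->
  cint (fun x => f1 x + f2 x) = cint f1 + cint f2.
Proof.
move=> [r1 i1] [r2 i2]; rewrite /cint.
have mD := @measurable_disk R.
rewrite -[RHS]/((_ + _) +i* (_ + _)) -!RintegralD//; try exact: bounded_mfun_integrable.
by congr Complex; apply: eq_Rintegral => x _; case: (f1 x) (f2 x) => ? ? [].
Qed.

Lemma cintZ (c : R[i]) f : bounded_cmfun f ->
  cint (fun x => c * f x) = c * cint f.
Proof.
move=> [r i]; rewrite /cint; have mD := @measurable_disk R.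
case: c => a b; rewrite -[RHS]/((_ - _) +i* (_ + _)).
have i1 := bounded_mfun_integrable r.
have i2 := bounded_mfun_integrable i.
have k1 (u : R) := bounded_mfun_integrable (bounded_mfunM (bounded_mfun_cst u) r).
have k2 (u : R) := bounded_mfun_integrable (bounded_mfunM (bounded_mfun_cst u) i).
rewrite -!RintegralZl// -RintegralB// -RintegralD//.
by congr Complex; apply: eq_Rintegral => x _; case: (f x).
Qed.

Lemma cint_sum m (F : 'I_m -> plane R -> R[i]) :
  (forall i, bounded_cmfun (F i)) ->
  cint (fun x => \sum_(i < m) F i x) = \sum_(i < m) cint (F i).
Proof.
elim: m F => [|m ih] F bF.
  rewrite big_ord0 (@eq_cint _ (fun=> 0 * 0)); last by move=> x _; rewrite big_ord0 mul0r.
  by rewrite cintZ ?mul0r//; exact: bounded_cmfun_cst.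
rewrite big_ord_recr/= -ih// -cintD//; last exact: bounded_cmfun_sum.
by apply: eq_cint => x _; rewrite big_ord_recr.
Qed.

(** Change of variables for the image of nu under the rotation, which is nu. *)
Lemma cint_rot phi f :
  (forall A, measurable A -> nu (rot phi @^-1` A) = nu A) ->
  bounded_cmfun f -> cint (fun x => f (rot phi x)) = cint f.
Proof.
move=> nu_rot [r i].
have mD := @measurable_disk R.
have rotD : rot phi @^-1` disk = disk.
  by apply/seteqP; split => x /= ?; apply/(disk_rot phi).
suff rint g : bounded_mfun g ->
    \int[nu]_(x in disk) g (rot phi x) = \int[nu]_(x in disk) g x.
  by congr Complex; [exact: (rint _ r)|exact: (rint _ i)].
move=> bg; have [mg [M gM]] := bg; congr fine.
rewrite (_ : \int[nu]_(x in disk) (g x)%:E =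
    \int[pushforward nu (rot phi)]_(x in disk) (EFin \o g) x)%E; last first.
  pose push : {measure set (plane R) -> \bar R} := pushforward nu (rot phi).
  apply: (@eq_measure_integral _ _ _ _ (push (measurable_rot phi))) => A mA _.
  exact/esym/nu_rot.
rewrite integral_pushforward//.
- by rewrite rotD.
- exact: measurable_rot.
- exact/measurable_EFinP.
- rewrite rotD; apply: (@bounded_mfun_integrable (g \o rot phi)); split.
    by apply: measurableT_comp => //; exact: measurable_rot.
  by exists M => x dx; apply: gM; apply/disk_rot.
Qed.

End ComplexIntegral.

(** * Independence of the orthonormal basis *)

Section OrthonormalBases.
Context {R : realType} (nu : probability (plane R) R).

Lemma sq_normE (z : R[i]) : (sq_norm z)%:C = z * z^*%C.
Proof.
case: z => a b; rewrite /sq_norm/= sqr_sqrtr ?addr_ge0 ?sqr_ge0//.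
by rewrite -[RHS]/((_ - _) +i* (_ + _)); congr Complex; ring.
Qed.

(** If e = A b with both families orthonormal, then A A^* = 1; as A is square,
    also A^* A = 1, and the latter says that A preserves the sum of squares. *)
Lemma sum_sq_orthonormal m (b e : 'I_m -> plane R -> R[i]) (x : plane R) :
  (forall i, bounded_cmfun (b i)) ->
  (forall i j, inner_disk nu (b i) (b j) = (i == j)%:R) ->
  (forall i, span_on_disk b (e i)) ->
  (forall i j, inner_disk nu (e i) (e j) = (i == j)%:R) ->
  disk x -> sum_sq e x = sum_sq b x.
Proof.
move=> bb ortho_b /choice[A eA] ortho_e dx.
have eJ (i j : 'I_m) y : disk y ->
    e i y * (e j y)^*%C = \sum_(k < m) \sum_(l < m)
      (A i k * (A j l)^*%C) * (b k y * (b l y)^*%C).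
  move=> dy; rewrite !eA// rmorph_sum/= mulr_suml; apply: eq_bigr => k _.
  rewrite mulr_sumr; apply: eq_bigr => l _.
  by rewrite rmorphM/=; ring.
have bbJ k l : bounded_cmfun (fun y => b k y * (b l y)^*%C).
  by apply: bounded_cmfunM => //; exact: bounded_cmfunJ.
have bZ (c : R[i]) k l : bounded_cmfun (fun y => c * (b k y * (b l y)^*%C)).
  by apply: bounded_cmfunM => //; exact: bounded_cmfun_cst.
pose M := \matrix_(i < m, j < m) A i j.
(* N is the conjugate transpose of M. *)
pose N := \matrix_(i < m, j < m) (A j i)^*%C.
have MN : M *m N = 1%:M.
  apply/matrixP => i j; rewrite !mxE -ortho_e inner_diskE.
  rewrite (eq_cint _ (eJ i j)) cint_sum; last first.
    by move=> k; apply: bounded_cmfun_sum => l; exact: bZ.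
  apply: eq_bigr => k _; rewrite !mxE cint_sum; last by move=> l; exact: bZ.
  rewrite (bigD1 k)//= big1 ?addr0; last first.
    move=> l lk; rewrite cintZ// -inner_diskE ortho_b eq_sym (negbTE lk).
    by rewrite mulr0.
  by rewrite cintZ// -inner_diskE ortho_b eqxx mulr1.
have NM : forall k l, \sum_(i < m) A i k * (A i l)^*%C = (k == l)%:R.
  move=> k l; have /matrixP/(_ l k) := mulmx1C MN; rewrite !mxE eq_sym => <-.
  by apply: eq_bigr => i _; rewrite !mxE mulrC.
apply: (@complexI R); rewrite /sum_sq !rmorph_sum/=.
under eq_bigr do rewrite sq_normE eJ//.
rewrite exchange_big/=; apply: eq_bigr => k _.
rewrite exchange_big/= (bigD1 k)//= [X in _ + X]big1 ?addr0 => [|l lk].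
  by rewrite -mulr_suml NM eqxx mul1r sq_normE.
by rewrite -mulr_suml NM eq_sym (negbTE lk) mul0r.
Qed.

End OrthonormalBases.

(** * Symmetries and orthogonality of the Fourier-Bessel functions *)

Section FourierBessel.
Context {R : realType} (lam : R).
Implicit Types (x : plane R) (j k : int) (n : nat) (phi t : R).

Lemma expiD t phi : expi (t + phi) = expi t * expi phi.
Proof.
rewrite /expi cosD sinD -[RHS]/((_ - _) +i* (_ + _)); congr Complex.
by rewrite addrC [cos t * _]mulrC mulrC.
Qed.

Lemma expi_natmul n t : expi (n%:R * t) = expi t ^+ n.
Proof.
elim: n => [|n ih]; first by rewrite mul0r expr0 /expi cos0 sin0.
by rewrite -natr1 mulrDl mul1r expiD ih exprSr.
Qed.

Lemma expiJ t : (expi t)^*%C = expi (- t).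
Proof. by rewrite /expi cosN sinN. Qed.

Lemma conjcM (z w : R[i]) : (z * w)^*%C = z^*%C * w^*%C.
Proof. exact: rmorphM. Qed.

Lemma fourier_bessel_rot j phi x :
  fourier_bessel lam j (rot phi x) = expi (j%:~R * phi) * fourier_bessel lam j x.
Proof.
rewrite [in LHS](polarE x); set t := angle x; set r := radius x.
have -> : rot phi (r * cos t, r * sin t) = (r * cos (t + phi), r * sin (t + phi)).
  by rewrite /rot/= cosD sinD; congr pair; ring.
rewrite fourier_besselE ?sqrtr_ge0// mulrDr expiD.
by rewrite /fourier_bessel -/t -/r mulrCA mulrA.
Qed.

Lemma sq_normM (z w : R[i]) : sq_norm (z * w) = sq_norm z * sq_norm w.
Proof. by rewrite /sq_norm Normc.normcM exprMn. Qed.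

Lemma sq_norm_real (r : R) : sq_norm r%:C = r ^+ 2.
Proof. by rewrite /sq_norm/= expr0n/= addr0 sqr_sqrtr ?sqr_ge0. Qed.

Lemma sq_norm_expi t : sq_norm (expi t) = 1.
Proof. by rewrite /sq_norm/= cos2Dsin2 sqrtr1 expr1n. Qed.

Lemma sqr_bessel j (y : R) : bessel j y ^+ 2 = bessel_sqr `|j|%N ((y / 2) ^+ 2).
Proof.
have nat_sqr n : bessel_nat n y ^+ 2 = bessel_sqr n ((y / 2) ^+ 2).
  by rewrite bessel_natE exprMn /bessel_sqr -!exprM mulnC.
case: j => n /=; first exact: nat_sqr.
by rewrite exprMn sqrr_sign mul1r nat_sqr.
Qed.

Lemma sq_norm_fourier_bessel j x :
  sq_norm (fourier_bessel lam j x) = bessel_sqr `|j|%N ((lam / 2) ^+ 2 * sqrad x).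
Proof.
rewrite /fourier_bessel sq_normM sq_norm_expi mul1r sq_norm_real sqr_bessel.
by rewrite -sqr_radius; congr bessel_sqr; ring.
Qed.

(** A form without the polar angle, from which measurability is apparent. *)
Lemma fourier_bessel_natE n x : fourier_bessel lam n%:Z x =
  ((lam / 2)%:C * (x.1 +i* x.2)) ^+ n *
  (clifford n ((lam / 2) ^+ 2 * sqrad x))%:C.
Proof.
have -> : x.1 +i* x.2 = (radius x)%:C * expi (angle x).
  rewrite {1 2}(polarE x) /expi -[RHS]/((_ - _) +i* (_ + _)).
  by rewrite !mul0r subr0 addr0.
have -> : fourier_bessel lam n%:Z x = expi (n%:R * angle x) *
    ((lam * radius x / 2) ^+ n * clifford n ((lam * radius x / 2) ^+ 2))%:C.
  by rewrite -bessel_natE.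
rewrite expi_natmul rmorphM/= rmorphXn/= [LHS]mulrA -exprMn.
rewrite (_ : (lam * radius x / 2) ^+ 2 = (lam / 2) ^+ 2 * sqrad x); last first.
  by rewrite -sqr_radius; ring.
congr (_ ^+ _ * _); rewrite (_ : lam * radius x / 2 = lam / 2 * radius x); last by ring.
by rewrite rmorphM/= mulrC mulrA.
Qed.

Lemma fourier_bessel_NegzE n x : fourier_bessel lam (Negz n) x =
  (-1) ^+ n.+1 * (fourier_bessel lam n.+1 x)^*%C.
Proof.
have -> : fourier_bessel lam (Negz n) x = expi (- (n.+1%:R * angle x)) *
    ((-1) ^+ n.+1 * bessel_nat n.+1 (lam * radius x))%:C.
  by rewrite /fourier_bessel NegzE rmorphN/= mulNr.
have -> : (fourier_bessel lam n.+1 x)^*%C = expi (- (n.+1%:R * angle x)) *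
    (bessel_nat n.+1 (lam * radius x))%:C.
  by rewrite /fourier_bessel conjcM expiJ conjc_real.
by rewrite (rmorphM (real_complex R)) rmorph_sign mulrCA.
Qed.

Lemma bounded_mfun_comp_sqrad (f : R -> R) : continuous f ->
  bounded_mfun (fun x : plane R => f (sqrad x)).
Proof.
move=> cf; split.
  apply: (@measurableT_comp _ _ _ _ _ _ (f : measurableTypeR R -> measurableTypeR R)).
    exact: continuous_measurable_fun.
  exact: measurable_sqrad.
have cnf : {within `[0, 1], continuous (fun r => `|f r|)}.
  apply: continuous_subspaceT => r; apply: cvg_norm; exact: cf.
have [c _ fc] := EVT_max ler01 cnf.
by exists `|f c| => x /diskE x1; apply: fc; rewrite in_itv/= sqrad_ge0.
Qed.

Lemma bounded_cmfun_fourier_bessel j : bounded_cmfun (fourier_bessel lam j).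
Proof.
have bnat n : bounded_cmfun (fourier_bessel lam n%:Z).
  rewrite (_ : fourier_bessel lam _ = fun x => ((lam / 2)%:C * (x.1 +i* x.2)) ^+ n *
    (clifford n ((lam / 2) ^+ 2 * sqrad x))%:C); last first.
    by apply/funext => x; rewrite fourier_bessel_natE.
  apply: bounded_cmfunM; last first.
    apply: bounded_cmfun_real.
    apply: (@bounded_mfun_comp_sqrad (fun r => clifford n ((lam / 2) ^+ 2 * r))) => r.
    apply: continuous_comp; last exact: continuous_clifford.
    exact: mulrl_continuous.
  apply: bounded_cmfunX; apply: bounded_cmfunM; first exact: bounded_cmfun_cst.
  have coord_le (u v : R) : u ^+ 2 + v ^+ 2 <= 1 -> `|u| <= 1.
    move=> h; rewrite -(@ler_pXn2r _ 2)// ?nnegrE// expr1n real_normK ?num_real//.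
    by rewrite (le_trans _ h)// lerDl sqr_ge0.
  split; split.
  - exact: measurable_fst.
  - by exists 1 => x /diskE; exact: coord_le.
  - exact: measurable_snd.
  - by exists 1 => x /diskE; rewrite /sqrad addrC; exact: coord_le.
case: j => n; first exact: bnat.
rewrite (_ : fourier_bessel lam _ = fun x => (-1) ^+ n.+1 * (fourier_bessel lam n.+1 x)^*%C).
  by apply: bounded_cmfunM; [exact: bounded_cmfun_cst|exact: bounded_cmfunJ].
by apply/funext => x; rewrite fourier_bessel_NegzE.
Qed.

Lemma cos_half_neq1 : cos (2^-1 : R) != 1.
Proof.
have pi1 := @pihalf_ge1 R.
have h2 : 2^-1 \in `[0, (pi : R)] by rewrite in_itv/=; apply/andP; split; lra.
have h0 : 0 \in `[0, (pi : R)] by rewrite in_itv/= lexx pi_ge0.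
rewrite -[X in _ != X]cos0; apply/eqP => c12; have /eqP := cos_inj h2 h0 c12.
by rewrite invr_eq0 pnatr_eq0.
Qed.

(** A rotation that preserves the measure multiplies the inner product by the
    phase exp(i (j - k) phi); for a phase different from one it must vanish. *)
Lemma inner_fourier_bessel_neq (alpha : {i01 R}) j k : j != k ->
  inner_disk (disk_circle alpha) (fourier_bessel lam j) (fourier_bessel lam k) = 0.
Proof.
move=> jk; rewrite inner_diskE.
pose d : R := `|(j - k)%:~R|.
have d1 : 1 <= d.
  by rewrite /d -intr_norm (ler_int _ 1) -gtz0_ge1 normr_gt0 subr_eq0.
have d0 : 0 < d by rewrite (lt_le_trans _ d1).
(* The phase below is then exp(i / 2) or its conjugate. *)
pose phi : R := (2 * d)^-1.
have phi0 : 0 < phi by rewrite invr_gt0 mulr_gt0.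
have phi1 : phi <= 2^-1 by rewrite lef_pV2 ?posrE ?mulr_gt0// ler_peMr.
have pi1 := @pihalf_ge1 R.
have c0 : 0 < cos phi by apply: cos_gt0_pihalf; apply/andP; split; lra.
have phi2pi : 0 <= phi <= 2 * pi by apply/andP; split; lra.
set f := (fun x => _).
have bf : bounded_cmfun f.
  apply: bounded_cmfunM; first exact: bounded_cmfun_fourier_bessel.
  by apply: bounded_cmfunJ; exact: bounded_cmfun_fourier_bessel.
have fE x : f (rot phi x) = expi ((j - k)%:~R * phi) * f x.
  rewrite /f !fourier_bessel_rot conjcM expiJ rmorphB/= mulrBl expiD; ring.
have := cint_rot (fun A => disk_circle_rot alpha c0 phi2pi) bf.
rewrite (eq_cint _ (fun x _ => fE x)) cintZ//; set I := cint _ _ => /eqP.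
rewrite -[X in _ == X]mul1r -subr_eq0 -mulrBl mulf_eq0 => /orP[|/eqP//].
rewrite subr_eq0 eq_complex/= => /andP[+ _].
have -> : cos ((j - k)%:~R * phi) = cos (2^-1 : R).
  have -> : 2^-1 = d * phi :> R by rewrite /phi; field; rewrite gt_eqF.
  rewrite /d; case: (ger0P ((j - k)%:~R : R)) => _ //.
  by rewrite mulNr cosN.
by rewrite (negbTE cos_half_neq1).
Qed.

End FourierBessel.

(** * The Christoffel function of the Fourier-Bessel space *)

Section Christoffel.
Context {R : realType} (lam : R) (lam_gt0 : 0 < lam) (alpha : {i01 R}).
Implicit Types (x : plane R) (n L : nat) (r : R).
Let nu := disk_circle alpha.
Let kap : R := (lam / 2) ^+ 2.

Let kap_gt0 : 0 < kap.
Proof. by rewrite exprn_gt0// divr_gt0. Qed.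

(** The squared L2 norm of the Fourier-Bessel functions of frequencies n and
    - n. *)
Definition fb_norm n : R :=
  \int[nu]_(x in disk) bessel_sqr n (kap * sqrad x).

Let continuous_profile n : continuous (fun r => bessel_sqr n (kap * r)).
Proof.
move=> r; apply: continuous_comp; last exact: continuous_bessel_sqr.
exact: mulrl_continuous.
Qed.

Let profile_ge0 n x : 0 <= bessel_sqr n (kap * sqrad x).
Proof. by rewrite bessel_sqr_ge0// mulr_ge0 ?sqrad_ge0 ?(ltW kap_gt0). Qed.

Let bounded_profile n : bounded_mfun (fun x => bessel_sqr n (kap * sqrad x)).
Proof. exact: bounded_mfun_comp_sqrad (@continuous_profile n). Qed.

Lemma fb_norm_EFin n :
  (fb_norm n)%:E = (\int[nu]_(x in disk) (bessel_sqr n (kap * sqrad x))%:E)%E.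
Proof.
rewrite /fb_norm /Rintegral fineK//.
apply: integrable_fin_num; first exact: measurable_disk.
exact: bounded_mfun_integrable (bounded_profile n).
Qed.

Lemma le_fb_norm n (c : R) (S : set (plane R)) : measurable S -> S `<=` disk ->
  0 <= c -> (forall x, S x -> c <= bessel_sqr n (kap * sqrad x)) ->
  (c%:E * nu S <= (fb_norm n)%:E)%E.
Proof.
move=> mS Sd c0 cS; rewrite fb_norm_EFin.
have mg D : measurable_fun D (fun x => (bessel_sqr n (kap * sqrad x))%:E).
  by apply/measurable_EFinP/measurable_funTS; have [] := bounded_profile n.
apply: (@le_trans _ _ (\int[nu]_(x in S) (bessel_sqr n (kap * sqrad x))%:E)%E).
  rewrite -integral_cst//; apply: ge0_le_integral => //.
apply: ge0_subset_integral => //; first exact: measurable_disk.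
by move=> x _; rewrite lee_fin.
Qed.

Lemma fb_norm_gt0 n : alpha%:num < 1 -> 0 < fb_norm n.
Proof.
move=> a1; have [e [c [e0 e1 c0 ce]]] := bessel_sqr_near0 n kap_gt0.
rewrite -lte_fin.
have mS := @measurable_annulus R (e / 2) e.
apply: lt_le_trans (le_fb_norm mS _ (ltW c0) (fun x => ce (sqrad x))); last first.
  by move=> x /= /andP[_ h]; apply/diskE; rewrite (le_trans h).
have e01 : 0 < e <= 1 by rewrite e0.
apply: lt_le_trans (lee_wpmul2l _ (disk_circle_annulus a1 e01)); last first.
  by rewrite lee_fin ltW.
by rewrite -EFinM lte_fin !mulr_gt0// ?subr_gt0// divr_gt0.
Qed.

(** The circle has mass at least alpha and the integrand is constant there. *)
Lemma fb_norm_ge n : alpha%:num * bessel_sqr n kap <= fb_norm n.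
Proof.
have mS : measurable [set x : plane R | sqrad x = 1].
  exact: (@measurable_preimage_sqrad R [set 1]).
have q0 : 0 <= bessel_sqr n kap by rewrite bessel_sqr_ge0// ltW.
rewrite -lee_fin; apply: le_trans (le_fb_norm mS _ q0 _).
- by rewrite mulrC EFinM lee_wpmul2l ?lee_fin// disk_circle_circle.
- by move=> x /= x1; apply/diskE; rewrite x1.
- by move=> x /= ->; rewrite mulr1.
Qed.

Lemma fb_norm_le n : alpha%:num = 0 -> 4 * (kap * expR kap) <= n.+1%:R ->
  fb_norm n <= 25 / 16 * (kap ^+ n / n`!%:R ^+ 2) / n.+1%:R.
Proof.
move=> a0 Kn; set c := 25 / 16 * _.
have c0 : 0 <= c.
  by rewrite /c !(mulr_ge0, divr_ge0, exprn_ge0)// ltW.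
rewrite -lee_fin fb_norm_EFin.
have mg (f : R -> R) D : continuous f -> measurable_fun D (fun x : plane R => (f (sqrad x))%:E).
  by move=> cf; apply/measurable_EFinP/measurable_funTS; have [] := bounded_mfun_comp_sqrad cf.
have mD := @measurable_disk R.
apply: (@le_trans _ _ (\int[nu]_(x in disk) (c%:E * (sqrad x ^+ n)%:E))%E).
  apply: ge0_le_integral => //.
  - by move=> x _; rewrite lee_fin.
  - by apply: (mg (fun r => bessel_sqr n (kap * r))); exact: continuous_profile.
  - apply: (mg (fun r => c * r ^+ n)) => r.
    by apply: cvgMl_tmp; exact: exprn_continuous.
  - move=> x /diskE x1; rewrite -EFinM lee_fin.
    by apply: bessel_sqr_le_pow; rewrite ?sqrad_ge0// ltW.
rewrite ge0_integralZl//; last 2 first.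
  by apply: (mg (fun r => r ^+ n)); exact: exprn_continuous.
  by move=> x _; rewrite lee_fin exprn_ge0// sqrad_ge0.
rewrite (EFinM c) lee_wpmul2l ?lee_fin//.
exact: disk_unif_sqrad_moment.
Qed.

(** The sum of squares of the normalized Fourier-Bessel functions, as a function
    of the squared radius. *)
Definition fb_christoffel L r : R :=
  \sum_(i < L.*2.+1) bessel_sqr `|i%:Z - L%:Z|%N (kap * r) /
                      fb_norm `|i%:Z - L%:Z|%N.

Definition fb_basis L (i : 'I_(L.*2.+1)) x : R[i] :=
  ((Num.sqrt (fb_norm `|i%:Z - L%:Z|%N))^-1)%:C *
  fourier_bessel lam (i%:Z - L%:Z) x.
Arguments fb_basis : clear implicits.

Lemma bounded_cmfun_fb_basis L i : bounded_cmfun (fb_basis L i).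
Proof.
apply: bounded_cmfunM; first exact: bounded_cmfun_cst.
exact: bounded_cmfun_fourier_bessel.
Qed.

Lemma sum_sq_fb_basis L x : sum_sq (fb_basis L) x = fb_christoffel L (sqrad x).
Proof.
apply: eq_bigr => i _; rewrite sq_normM sq_norm_real sq_norm_fourier_bessel.
rewrite exprVn sqr_sqrtr 1?mulrC// /fb_norm.
by apply: Rintegral_ge0 => y _; exact: profile_ge0.
Qed.

Lemma inner_fourier_bessel_eq j :
  inner_disk nu (fourier_bessel lam j) (fourier_bessel lam j) = (fb_norm `|j|%N)%:C.
Proof.
rewrite inner_diskE (@eq_cint _ nu _ (fun x => (bessel_sqr `|j|%N (kap * sqrad x))%:C)).
  by congr Complex; rewrite Rintegral_cst ?mul0r//; exact: measurable_disk.
by move=> x _; rewrite -sq_normE sq_norm_fourier_bessel.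
Qed.

Lemma inner_fb_basis L i j : alpha%:num < 1 ->
  inner_disk nu (fb_basis L i) (fb_basis L j) = (i == j)%:R.
Proof.
move=> a1; pose a i : R[i] := ((Num.sqrt (fb_norm `|i%:Z - L%:Z|%N))^-1)%:C.
pose fb i := fourier_bessel lam (i%:Z - L%:Z).
have -> : inner_disk nu (fb_basis L i) (fb_basis L j) =
    a i * a j * inner_disk nu (fb i) (fb j).
  rewrite !inner_diskE -cintZ; last first.
    apply: bounded_cmfunM; first exact: bounded_cmfun_fourier_bessel.
    by apply: bounded_cmfunJ; exact: bounded_cmfun_fourier_bessel.
  by apply: eq_cint => x _; rewrite /fb_basis conjcM conjc_real mulrACA.
have [->|ij] := eqVneq i j.
  rewrite inner_fourier_bessel_eq /a -!rmorphM/= -expr2 exprVn sqr_sqrtr.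
    by rewrite mulVf ?gt_eqF ?fb_norm_gt0.
  by rewrite ltW ?fb_norm_gt0.
rewrite inner_fourier_bessel_neq ?mulr0//.
by rewrite (inj_eq (addIr _)) eqz_nat.
Qed.

Lemma orthonormal_fb_basis L : alpha%:num < 1 ->
  orthonormal_basis nu (fourier_bessel_space lam L) (fb_basis L).
Proof.
move=> a1; split.
- move=> i; exists (fun k => (k == i)%:R *
    ((Num.sqrt (fb_norm `|i%:Z - L%:Z|%N))^-1)%:C) => x _.
  rewrite (bigD1 i)//= big1 ?addr0 ?eqxx ?mul1r// => k ki.
  by rewrite (negbTE ki) !mul0r.
- move=> f [c fc]; exists (fun k => c k *
    (Num.sqrt (fb_norm `|k%:Z - L%:Z|%N))%:C) => x dx.
  rewrite fc//; apply: eq_bigr => k _; rewrite /fb_basis -mulrA; congr (_ * _).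
  rewrite mulrA -rmorphM/= divff ?mul1r// gt_eqF// sqrtr_gt0.
  exact: fb_norm_gt0.
- move=> i; have bi := bounded_cmfun_fb_basis i; have [[mr _] [mi _]] := bi.
  split; [exact: measurable_funTS|exact: measurable_funTS|].
  have [[mN bN] _] := bounded_cmfunM bi (bounded_cmfunJ bi).
  have := bounded_mfun_integrable nu (conj mN bN).
  rewrite (_ : EFin \o _ = fun x => (sq_norm (fb_basis L i x))%:E)//.
  apply/funext => x.
  by rewrite -[LHS]/((complex.Re (fb_basis L i x * (fb_basis L i x)^*%C))%:E) -sq_normE.
- by move=> i j; exact: inner_fb_basis.
Qed.

(** The sum of squares is the same for all orthonormal bases and depends
    continuously on the squared radius, which ranges over a compact interval. *)
Lemma is_K_fourier_bessel L : alpha%:num < 1 ->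
  exists2 k : R, is_K L.*2.+1 (fourier_bessel_space lam L) nu k &
    (exists2 r, 0 <= r <= 1 & k = fb_christoffel L r) /\
    (forall r, 0 <= r <= 1 -> fb_christoffel L r <= k).
Proof.
move=> a1.
have cF : continuous (fb_christoffel L).
  apply: continuous_big => [|i _ r]; first exact: add_continuous.
  by apply: cvgMr_tmp; exact: continuous_profile.
have [r0 r01 kmax] := EVT_max ler01 (continuous_subspaceT cF).
exists (fb_christoffel L r0); last first.
  by split; [exists r0|move=> r r1; apply: kmax].
have sumE (e : 'I_(L.*2.+1) -> plane R -> R[i]) :
    orthonormal_basis nu (fourier_bessel_space lam L) e ->
    forall x, disk x -> sum_sq e x = fb_christoffel L (sqrad x).
  move=> [eV _ _ eo] x dx; have [_ bV _ bo] := orthonormal_fb_basis L a1.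
  rewrite (sum_sq_orthonormal (@bounded_cmfun_fb_basis L) bo _ eo dx).
    exact: sum_sq_fb_basis.
  by move=> i; apply: bV.
split; first by exists (fb_basis L); exact: orthonormal_fb_basis.
move=> e eo; split; last first.
  move=> _ [x dx <-]; rewrite (sumE _ eo)//; apply: kmax.
  by rewrite in_itv/= sqrad_ge0/=; apply/diskE.
have sr : sqrad (Num.sqrt r0, 0) = r0.
  rewrite /sqrad/= expr0n addr0 sqr_sqrtr//.
  by move: r01; rewrite in_itv => /andP[].
have dr : disk (Num.sqrt r0, 0).
  by apply/diskE; rewrite sr; move: r01; rewrite in_itv => /andP[].
by exists (Num.sqrt r0, 0) => //; rewrite (sumE _ eo)// sr.
Qed.

End Christoffel.

(** * Sums over symmetric frequencies and the two bounds *)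

Section SymmetricSums.
Context {R : realType}.
Implicit Types (F D : nat -> R) (L N : nat).

Definition symsum F L : R := \sum_(i < L.*2.+1) F `|i%:Z - L%:Z|%N.

Lemma symsum0 F : symsum F 0 = F 0%N.
Proof. by rewrite /symsum big_ord1. Qed.

(** Passing from L to L + 1 adds the two frequencies L + 1 and - (L + 1). *)
Lemma symsumS F L : symsum F L.+1 = symsum F L + 2 * F L.+1.
Proof.
transitivity (F L.+1 + symsum F L + F L.+1); last by ring.
rewrite /symsum doubleS big_ord_recr big_ord_recl/=; congr (_ + _ + _).
- by congr F; lia.
- by apply: eq_bigr => i _; congr F; rewrite /bump/=; lia.
- by congr F; lia.
Qed.

Lemma symsum_le_double D L N : (forall n, 0 <= D n) ->
  (forall n, (N <= n)%N -> D n = 0) -> symsum D L <= 2 * \sum_(n < N) D n.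
Proof.
move=> D0 DN.
have : symsum D L <= 2 * \sum_(n < L.+1) D n.
  elim: L => [|L ih].
    by rewrite symsum0 big_ord1 mulrDl mul1r lerDl.
  by rewrite symsumS big_ord_recr/= mulrDr lerD2r.
move=> /le_trans; apply; rewrite ler_pM2l//.
rewrite -!(big_mkord xpredT).
apply: (@le_trans _ _ (\sum_(0 <= n < N + L.+1) D n)).
  rewrite [leRHS](@big_cat_nat _ _ _ L.+1)//= ?leq_addl//.
  by rewrite lerDl sumr_ge0.
rewrite (@big_cat_nat _ _ _ N)//= ?leq_addr// [X in _ + X]big1_seq ?addr0//.
by move=> n; rewrite mem_index_iota => /andP[_ /andP[Nn _]]; exact: DN.
Qed.

(** The increment 2 F(L+1) >= 2 c (L + 2) of the sum exceeds the increment
    c (2 L + 1) of c L^2; below N the left-hand side is not positive. *)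
Lemma symsum_ge_quadratic F (c : R) L N : 0 <= c -> (forall n, 0 <= F n) ->
  (forall n, (N <= n)%N -> c * n.+1%:R <= F n) ->
  c * (L%:R ^+ 2 - N%:R ^+ 2) <= symsum F L.
Proof.
move=> c0 F0 FN.
have S0 K : 0 <= symsum F K by apply: sumr_ge0.
have [LN|NL] := leqP L N.
  rewrite (le_trans _ (S0 L))// mulr_ge0_le0// subr_le0.
  by rewrite lerXn2r ?nnegrE ?ler_nat.
elim: L NL => // L ih; rewrite ltnS => NL.
rewrite symsumS.
have hL : c * (L%:R ^+ 2 - N%:R ^+ 2) <= symsum F L.
  move: NL; rewrite leq_eqVlt => /predU1P[->|]; last exact: ih.
  by rewrite subrr mulr0.
have := FN L.+1 (leqW NL); rewrite -!natr1 => h.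
have : 0 <= c * L%:R by rewrite mulr_ge0.
nra.
Qed.

End SymmetricSums.

Section Bounds.
Context {R : realType} (lam : R) (lam_gt0 : 0 < lam).
Let kap : R := (lam / 2) ^+ 2.

Let kap_gt0 : 0 < kap.
Proof. by rewrite exprn_gt0// divr_gt0. Qed.

(** From this frequency on, the leading term of the power series dominates on
    the whole disk. *)
Lemma exists_threshold : exists N : nat, (2 <= N)%N /\
  forall n, (N <= n)%N -> 4 * (kap * expR kap) <= n.+1%:R.
Proof.
have [N hN] : exists N : nat, 4 * (kap * expR kap) <= N%:R.
  exists (Num.bound (4 * (kap * expR kap))).
  rewrite ltW// archi_boundP// mulr_ge0// mulr_ge0 ?expR_ge0//.
  exact: ltW kap_gt0.
exists N.+2; split => // n Nn; rewrite (le_trans hN)// ler_nat; lia.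
Qed.

Lemma fb_christoffelE (alpha : {i01 R}) L r : fb_christoffel lam alpha L r =
  symsum (fun n => bessel_sqr n (kap * r) / fb_norm lam alpha n) L.
Proof. by []. Qed.

(** Evaluation on the unit circle, where each high frequency contributes at
    least 9/25 (n + 1), the ratio of (3/4)^2 and (5/4)^2 times n + 1. *)
Lemma fb_christoffel_ge (alpha : {i01 R}) : alpha%:num = 0 ->
  exists c0 : R, forall L, c0 + 1 / 16 * (L.*2.+1)%:R ^+ 2 <=
    fb_christoffel lam alpha L 1.
Proof.
move=> a0; have [N [_ hN]] := exists_threshold.
have a1 : alpha%:num < 1 by rewrite a0.
(* As 9/25 > 1/4, subtracting 1 makes up for the linear term of m^2 / 16 =
   (L + 1/2)^2 / 4. *)
exists (- (9 / 25 * N%:R ^+ 2) - 1) => L; rewrite fb_christoffelE.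
have wgt0 n := fb_norm_gt0 lam_gt0 n a1.
apply: (@le_trans _ _ (9 / 25 * (L%:R ^+ 2 - N%:R ^+ 2))).
  have -> : (L.*2.+1)%:R = 2 * L%:R + 1 :> R by rewrite -(natr1 L.*2) -mul2n natrM.
  have := sqr_ge0 (L%:R - 1 : R); have := sqr_ge0 (L%:R : R); nra.
apply: symsum_ge_quadratic => [//|n|n Nn].
  by rewrite divr_ge0 ?bessel_sqr_ge0 ?mulr1 ?(ltW kap_gt0)// ltW.
rewrite mulr1 ler_pdivlMr//.
have Q := bessel_sqr_ge (ltW kap_gt0) (hN _ Nn).
apply: le_trans Q; have W := fb_norm_le lam_gt0 a0 (hN _ Nn).
apply: (@le_trans _ _ (9 / 25 * n.+1%:R *
    (25 / 16 * (kap ^+ n / n`!%:R ^+ 2) / n.+1%:R))).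
  by rewrite ler_wpM2l// mulr_ge0.
rewrite [leLHS](_ : _ = 9 / 16 * (kap ^+ n / n`!%:R ^+ 2))//.
by field; rewrite pnatr_eq0 gtn_eqF ?fact_gt0//= addrC natr1 pnatr_eq0.
Qed.

(** Each frequency contributes at most 1 / alpha plus an excess D n that
    vanishes for large n, so that the excesses have a bounded sum. *)
Lemma fb_christoffel_le (alpha : {i01 R}) : 0 < alpha%:num -> alpha%:num < 1 ->
  exists C : R, forall L r, 0 <= r <= 1 ->
    fb_christoffel lam alpha L r <= C + (L.*2.+1)%:R / alpha%:num.
Proof.
move=> a0 a1; have [N [N2 hN]] := exists_threshold.
have wgt0 n := fb_norm_gt0 lam_gt0 n a1.
have excess n : exists D : R, [/\ 0 <= D, (N <= n)%N -> D = 0 &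
    forall r, 0 <= r <= 1 ->
      bessel_sqr n (kap * r) / fb_norm lam alpha n <= (alpha%:num)^-1 + D].
  have [Nn|nN] := leqP N n.
    exists 0; split => // r r01.
    rewrite addr0 ler_pdivrMr// ler_pdivlMl//.
    rewrite (le_trans _ (fb_norm_ge lam_gt0 alpha n))// ler_pM2l//.
    by apply: bessel_sqr_le => //; [exact: ltW|exact: leq_trans Nn|exact: hN].
  have cf : continuous (fun r : R => bessel_sqr n (kap * r) / fb_norm lam alpha n).
    move=> r; apply: cvgMr_tmp; apply: continuous_comp; last exact: continuous_bessel_sqr.
    exact: mulrl_continuous.
  have [c _ hc] := EVT_max ler01 (continuous_subspaceT cf).
  exists `|bessel_sqr n (kap * c) / fb_norm lam alpha n|; split => //.
  move=> r r01; rewrite (le_trans (hc r _))// (le_trans (ler_norm _))//.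
  by rewrite lerDr invr_ge0 ltW.
have /choice[D hD] := excess.
exists (2 * \sum_(n < N) D n) => L r r01; rewrite fb_christoffelE.
apply: (@le_trans _ _ (symsum (fun n => (alpha%:num)^-1 + D n) L)).
  by apply: ler_sum => i _; have [_ _] := hD `|i%:Z - L%:Z|%N; apply.
rewrite /symsum big_split/= sumr_const card_ord addrC -[X in _ + X]mulr_natl lerD2r.
by apply: symsum_le_double => n; [have [] := hD n|have [_ + _] := hD n].
Qed.

End Bounds.

Theorem theorem4p1 (R : realType) (lam : R) (lam_gt0 : 0 < lam) :
  (forall c1 : R, c1 < 1 / 16 ->
     exists (c0 : R) (M : nat), forall L : nat, (M <= L.*2.+1)%N ->
       exists2 k : R,
         is_K L.*2.+1 (fourier_bessel_space lam L) (disk_circle 0%:i01) k &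
         c0 + c1 * (L.*2.+1)%:R ^+ 2 <= k)
  /\
  (forall alpha : {i01 R}, 0 < alpha%:num -> alpha%:num < 1 ->
     exists (C : R) (M : nat), forall L : nat, (M <= L.*2.+1)%N ->
       exists2 k : R,
         is_K L.*2.+1 (fourier_bessel_space lam L) (disk_circle alpha) k &
         k <= C + (L.*2.+1)%:R / alpha%:num).
Proof.
split=> [c1 c1_lt|alpha a0 a1].
  have [c0 hc0] := @fb_christoffel_ge R lam lam_gt0 0%:i01 erefl.
  exists c0, 0%N => L _.
  have [k kK [_ kmax]] := @is_K_fourier_bessel R lam lam_gt0 0%:i01 L ltr01.
  exists k => //; apply: le_trans (kmax 1 _); last by rewrite ler01 lexx.
  apply: le_trans (hc0 L); rewrite lerD2l ler_wpM2r ?exprn_ge0//.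
  exact: ltW.
have [C hC] := fb_christoffel_le lam_gt0 a0 a1.
exists C, 0%N => L _.
have [k kK [[r r01 kE] _]] := is_K_fourier_bessel lam_gt0 L a1.
by exists k => //; rewrite kE hC.
Qed.
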